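(* Let $N>2$ be an integer, $h=1/(N-1)$, let $l_1,l_2\in\{2,\dots,N\}$ and $K=(x_{l_1-1},x_{l_1})\times(y_{l_2-1},y_{l_2})$. Let $\mu>0$ and let $\mathbf{a}\in\mathbb{R}^2$ be constant. For $j,s\in\mathbb{N}$ put $$\tilde\omega_{js}^{(K)}(x,y)=e^{\frac{1}{2\mu}(\mathbf{a}\cdot\mathbf{x})}\sin\left(\sqrt{\sigma_j^{(K)}}\,(x-x_{l_1})\right)\sin\left(\sqrt{\sigma_s^{(K)}}\,(y-y_{l_2})\right),\qquad \sigma_j^{(K)}=\left(\frac{j\pi}{h}\right)^2,\quad \sigma_s^{(K)}=\left(\frac{s\pi}{h}\right)^2,$$ with $\mathbf{x}=(x,y)$, and let $$p_K(\mathbf{x})=e^{-\frac{1}{\mu}(\mathbf{a}\cdot\mathbf{x})}.$$ Then the sequence $\{\tilde z_{js}^{(K)}\}_{j,s\in\mathbb{N}}$ given by $$\tilde z_{js}^{(K)}(x,y)=\frac{\tilde\omega_{js}^{(K)}(x,y)}{\|\tilde\omega_{js}^{(K)}\|_{p_K}}=\frac{2\,e^{\frac{1}{2\mu}(\mathbf{a}\cdot\mathbf{x})}}{h}\sin\left(\sqrt{\sigma_j^{(K)}}\,(x-x_{l_1})\right)\sin\left(\sqrt{\sigma_s^{(K)}}\,(y-y_{l_2})\right)$$ is complete in $H_0^1(K)$ and orthonormal in $L^2_{p_K}(K)$.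
   Context: The unit square $[0,1]\times[0,1]$ is divided into $(N-1)\times(N-1)$ squares of side $h=1/(N-1)$, with grid nodes $(x_{l_1},y_{l_2})$, $l_1,l_2=1,\dots,N$, so that $x_l-x_{l-1}=h$ and $y_l-y_{l-1}=h$ (i.e. $x_l=y_l=(l-1)h$). $\mathbb{N}=\{1,2,3,\dots\}$. $L^2_{p_K}(K)$ is the weighted space with inner product $(u,v)_{p_K}=\int_K p_K\,u\,v$ and norm $\|u\|_{p_K}=(u,u)_{p_K}^{1/2}$. ''Complete in $H_0^1(K)$'' means that the linear span is dense in $H_0^1(K)$. *)

(* Defs.v *)
From HB Require Import structures.
From mathcomp Require Import all_boot all_order all_algebra.
From mathcomp Require Import all_classical all_reals all_analysis.

Set Implicit Arguments.
Unset Strict Implicit.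
Unset Printing Implicit Defensive.
Import Order.TTheory GRing.Theory Num.Theory.
Import numFieldNormedType.Exports.

Local Open Scope classical_set_scope.
Local Open Scope ring_scope.

Definition lebesgue2 (R : realType) : set (R * R) -> \bar R :=
  ((@lebesgue_measure R) \x (@lebesgue_measure R))%E.

Definition integral2 (R : realType) (Omega : set (R * R)) (f : R * R -> R) : R :=
  Rintegral (@lebesgue2 R) Omega f.

(** Elements of function spaces on [Omega] are represented by functions on the
    whole plane; the values outside [Omega] are irrelevant. *)
Definition inL2 (R : realType) (Omega : set (R * R)) (p u : R * R -> R) : Prop :=
  measurable_fun Omega u /\
  (@lebesgue2 R).-integrable Omega (fun x => (p x * u x ^+ 2)%:E).

Definition L2inner (R : realType) (Omega : set (R * R))
    (p u v : R * R -> R) : R :=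
  integral2 Omega (fun x => p x * u x * v x).

Definition L2norm (R : realType) (Omega : set (R * R)) (p u : R * R -> R) : R :=
  Num.sqrt (L2inner Omega p u u).

Definition orthonormal_in_L2 (R : realType) (Omega : set (R * R))
    (p : R * R -> R) (I : eqType) (D : set I) (f : I -> R * R -> R) : Prop :=
  (forall i, D i -> inL2 Omega p (f i)) /\
  (forall i k, D i -> D k -> L2inner Omega p (f i) (f k) = (i == k)%:R).

Definition e1 (R : realType) : R * R := (1, 0).
Definition e2 (R : realType) : R * R := (0, 1).

Fixpoint Ck (R : realType) (k : nat) (f : R * R -> R) : Prop :=
  continuous f /\
  (if k is k'.+1 then
     [/\ forall x, derivable f x (e1 R), forall x, derivable f x (e2 R),
         Ck k' (fun x => 'D_(e1 R) f x) & Ck k' (fun x => 'D_(e2 R) f x)]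
   else True).

Definition test_function (R : realType) (Omega : set (R * R))
    (phi : R * R -> R) : Prop :=
  let supp := closure [set x | phi x != 0] in
  [/\ forall k, Ck k phi, compact supp & supp `<=` Omega].

Definition weak_derivative (R : realType) (Omega : set (R * R)) (v : R * R)
    (u g : R * R -> R) : Prop :=
  forall phi, test_function Omega phi ->
    integral2 Omega (fun x => u x * 'D_v phi x) =
    - integral2 Omega (fun x => g x * phi x).

Definition H1_gradient (R : realType) (Omega : set (R * R))
    (u g1 g2 : R * R -> R) : Prop :=
  [/\ inL2 Omega (cst 1) u, inL2 Omega (cst 1) g1, inL2 Omega (cst 1) g2,
      weak_derivative Omega (e1 R) u g1 & weak_derivative Omega (e2 R) u g2].

Definition inH1 (R : realType) (Omega : set (R * R)) (u : R * R -> R) : Prop :=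
  exists g1 g2, H1_gradient Omega u g1 g2.

(** [is_H1norm Omega u r] : [u] is in [H^1(Omega)] and its norm is [r].  The
    relation is functional in [r] on open sets, since weak derivatives are
    unique up to a null set. *)
Definition is_H1norm (R : realType) (Omega : set (R * R)) (u : R * R -> R)
    (r : R) : Prop :=
  exists g1 g2, H1_gradient Omega u g1 g2 /\
    r = Num.sqrt (L2norm Omega (cst 1) u ^+ 2 +
                  L2norm Omega (cst 1) g1 ^+ 2 + L2norm Omega (cst 1) g2 ^+ 2).

Definition H1_adherent (R : realType) (Omega : set (R * R))
    (A : set (R * R -> R)) (u : R * R -> R) : Prop :=
  forall eps : R, 0 < eps ->
    exists w r, [/\ A w, is_H1norm Omega (fun x => u x - w x) r & r < eps].

Definition inH10 (R : realType) (Omega : set (R * R)) (u : R * R -> R) : Prop :=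
  inH1 Omega u /\ H1_adherent Omega (test_function Omega) u.

Definition lin_span (R : realType) (F : set (R * R -> R)) : set (R * R -> R) :=
  [set w | exists (n : nat) (c : 'I_n -> R) (f : 'I_n -> R * R -> R),
     (forall i, F (f i)) /\ w = (fun x => \sum_(i < n) c i * f i x)].

Definition complete_in_H10 (R : realType) (Omega : set (R * R))
    (F : set (R * R -> R)) : Prop :=
  (forall f, F f -> inH10 Omega f) /\
  (forall u, inH10 Omega u -> H1_adherent Omega (lin_span F) u).

Definition mesh (R : realType) (N : nat) : R := (N.-1)%:R^-1.

Definition node (R : realType) (N l : nat) : R := (l.-1)%:R * mesh R N.

Definition cell (R : realType) (N l1 l2 : nat) : set (R * R) :=
  `]node R N l1.-1, node R N l1[%classic `*`
  `]node R N l2.-1, node R N l2[%classic.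

Definition dot (R : realType) (a x : R * R) : R := a.1 * x.1 + a.2 * x.2.

Definition sigma (R : realType) (N j : nat) : R := (j%:R * pi / mesh R N) ^+ 2.

Definition omega (R : realType) (N l1 l2 : nat) (mu : R) (a : R * R)
    (js : nat * nat) (x : R * R) : R :=
  expR ((2 * mu)^-1 * dot a x) *
  sin (Num.sqrt (sigma R N js.1) * (x.1 - node R N l1)) *
  sin (Num.sqrt (sigma R N js.2) * (x.2 - node R N l2)).

Definition weight (R : realType) (mu : R) (a x : R * R) : R :=
  expR (- (mu^-1 * dot a x)).

Definition zeta (R : realType) (N l1 l2 : nat) (mu : R) (a : R * R)
    (js : nat * nat) (x : R * R) : R :=
  omega N l1 l2 mu a js x /
  L2norm (@cell R N l1 l2) (weight mu a) (omega N l1 l2 mu a js).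

Definition pos_pairs : set (nat * nat) :=
  [set js | (0 < js.1)%N /\ (0 < js.2)%N].

(* Main.v *)
(* The weight cancels the exponential factors, so orthonormality reduces to the
   orthogonality of the functions sin(j pi (x - b) / (b - a)) on ]a, b[.

   Completeness.  Since elements of H^1_0 are limits of test functions, it is
   enough to approximate a test function, and, after dividing it by the
   exponential factor, a C^2 function f vanishing outside the cell by sine
   polynomials in the C^1 norm.  The mixed derivative of f is a uniform limit of
   polynomials in cos(pi (x - b) / (b - a)) and cos(pi (y - d) / (d - c))
   (Bernstein operators), hence of double cosine sums.  Integrating such a sum in
   both variables gives a U that is C^1-close to f; its terms without a sine
   factor are exactly the bilinear interpolation of U on the right and upper
   sides, which is small since f vanishes there.

   The sines belong to H^1_0: multiply them by the smooth cutoffs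
   exp(- 1 / ((n+1) (x - a) (b - x) - 1)) and conclude by dominated convergence. *)
Require Import Defs.
From mathcomp Require Import all_boot all_order all_algebra.
From mathcomp Require Import all_classical all_reals all_analysis.
From mathcomp Require Import measurable_realfun ring lra.
Set Implicit Arguments.
Unset Strict Implicit.
Unset Printing Implicit Defensive.
Import Order.TTheory GRing.Theory Num.Theory.
Import numFieldNormedType.Exports.
Local Open Scope classical_set_scope.
Local Open Scope ring_scope.

(** * Integration over a rectangle *)

(** Why the mixed derivative is the function to approximate: f, f_x and f_y each vanish on a side
    from which they are recovered by integration, so a single uniform estimate of f_xy passes to all
    three by the mean value theorem and controls the whole C^1 norm. The argument needs one
    continuous function that is both f_xy and f_yx. Since [Ck] only speaks of iterated partial
    derivatives, the symmetry of the mixed ones has to be proved.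

    Why cosines: the primitive of a cosine of positive frequency is a sine that vanishes at both
    ends, so only frequency 0, whose primitive is linear, violates the boundary conditions. The
    Bernstein variable is (1 + cos) / 2 because it maps each side bijectively onto [0, 1] and its
    powers are again cosine sums.

    The obstacle in the cutoffs is their derivative, which carries a factor n+1. It is harmless only
    against functions that vanish at both ends, and there an algebraic identity for exp(-1/t)
    absorbs the factor. *)

Lemma open_measurable2 (R : realType) (U : set (R * R)) :
  open U -> measurable U.
Proof.
move=> oU.
(* The measurable sets of the plane are generated by rectangles, so the open set is written as a
   countable union of squares with rational centre and radius 1/(n+1). *)
pose B (q : rat * rat * nat) : set (R * R) :=
  ball (ratr q.1.1 : R) (q.2.+1%:R^-1) `*` ball (ratr q.1.2 : R) (q.2.+1%:R^-1).
have -> : U = \bigcup_(q in [set q | B q `<=` U]) B q.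
  apply/seteqP; split => [[x y] Uxy|xy [q /= BU Bq]]; last exact: BU.
  move: oU; rewrite openE => /(_ _ Uxy); rewrite /interior /= => /nbhs_ballP[e /= e0 eU].
  have [n ne] : exists n : nat, n.+1%:R^-1 < e / 2.
    exists (Num.truncn (e / 2)^-1).
    rewrite invf_plt ?posrE//; last by rewrite divr_gt0.
    by rewrite truncnS_gt.
  have n0 : 0 < n.+1%:R^-1 :> R by rewrite invr_gt0.
  have dense_rat (z r : R) : 0 < r -> exists q : rat, ball (ratr q : R) r z.
    move=> r0; have [|q] := @rat_in_itvoo R (z - r) (z + r); first by lra.
    rewrite in_itv/= => /andP[q1 q2]; exists q.
    by rewrite /ball/= ltr_norml; apply/andP; split; lra.
  have rr_e : n.+1%:R^-1 + n.+1%:R^-1 <= e by rewrite ltW// (splitr e) ltrD.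
  have [p px] := dense_rat x _ n0; have [q qy] := dense_rat y _ n0.
  exists ((p, q), n); last by split.
  move=> [x' y'] [/= px' qy']; apply: eU; split => /=.
  - by have := ball_triangle (ball_sym px) px'; apply: le_ball.
  - by have := ball_triangle (ball_sym qy) qy'; apply: le_ball.
rewrite bigcup_mkcond; apply: countable_bigcupT_measurable.
  exact: countableP.
by move=> q; case: ifP => // _; apply: measurableX; exact: measurable_ball.
Qed.

Lemma continuous_measurable2 (R : realType) (D : set (R * R)) (f : R * R -> R) :
  measurable D -> continuous f -> measurable_fun D f.
Proof.
move=> mD cf; apply: (measurable_funS measurableT) => //.
apply: (measurability _ (RGenOpens.measurableE R)).
move=> _ [_ [u [v ->] <-]]; rewrite setTI; apply: open_measurable2.
by move: cf => /continuousP; apply; exact: interval_open.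
Qed.

(* [lebesgue_measure] lives on [measurableTypeR R], whose display differs from
   the one found on [R] by inference: [integral2] is an integral over the first
   structure, whereas [inL2] asks for integrability over the second.  The two
   have the same measurable sets, and pushing forward along the identity shows
   that they have the same integrals. *)
Definition plane (R : realType) := (measurableTypeR R * measurableTypeR R)%type.

Definition integrable2 (R : realType) (D : set (R * R)) (f : R * R -> R) : Prop :=
  @integrable _ (plane R) R (@lebesgue2 R) D (EFin \o f).

Lemma integrable2P (R : realType) (D : set (R * R)) (f : R * R -> R) :
  measurable D ->
  (@lebesgue2 R).-integrable D (EFin \o f) <-> integrable2 D f.
Proof.
move=> mD.
pose i : plane R -> (R * R)%type := id.
have mi : measurable_fun setT i by move=> _ Y mY; rewrite setTI.
have E : measurable_fun D (EFin \o f) ->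
    (\int[@lebesgue2 R]_(x in D) `|(EFin \o f) x| =
     @integral _ (plane R) R (@lebesgue2 R) D (fun x => `|(EFin \o f) x|))%E.
  move=> mf.
  have := @ge0_integral_pushforward _ _ (plane R) (R * R)%type R i mi
    ((@lebesgue_measure R) \x (@lebesgue_measure R))%E D (fun x => `|(EFin \o f) x|)%E.
  apply => //.
  - exact: measurableT_comp.
by split => /integrableP [mf fi]; apply/integrableP; split => //; rewrite ?E// -?E.
Qed.

Definition rect (R : realType) (a b c d : R) : set (R * R) :=
  `]a, b[%classic `*` `]c, d[%classic.

Lemma continuous_pairl (R : realType) (f : R * R -> R) y :
  continuous f -> continuous (fun x => f (x, y)).
Proof.
move=> cf x; apply: (continuous_comp (f := fun x => (x, y)) (g := f)).
  by apply: (@cvg_pair _ _ _ _ (nbhs x) (nbhs y)); [exact: cvg_id|exact: cvg_cst].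
exact: cf.
Qed.

Lemma continuous_pairr (R : realType) (f : R * R -> R) x :
  continuous f -> continuous (fun y => f (x, y)).
Proof.
move=> cf y; apply: (continuous_comp (f := fun y => (x, y)) (g := f)).
  by apply: (@cvg_pair _ _ _ _ (nbhs x) (nbhs y)); [exact: cvg_cst|exact: cvg_id].
exact: cf.
Qed.

Lemma continuous_integrable_itv (R : realType) (g : R -> R) (a b : R) :
  continuous g ->
  @integrable _ (measurableTypeR R) R (@lebesgue_measure R) `]a, b[%classic (EFin \o g).
Proof.
move=> cg.
have cab : @integrable _ (measurableTypeR R) R (@lebesgue_measure R)
    `[a, b]%classic (EFin \o g).
  apply: continuous_compact_integrable; first exact: segment_compact.
  exact: continuous_subspaceT.
apply: (integrableS _ _ _ cab); [exact: measurable_itv|exact: measurable_itv|].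
exact: subset_itv_oo_cc.
Qed.

Section RectangleIntegral.
Context (R : realType) (a b c d : R) (ab : a < b) (cd : c < d).
Local Notation K := (rect a b c d).
Local Notation mu := (@lebesgue_measure R).
Implicit Types (f g : R * R -> R).

Lemma measurable_rect : measurable K.
Proof. by apply: measurableX; exact: measurable_itv. Qed.

Lemma lebesgue2_rect : (mu \x mu)%E K = ((b - a) * (d - c))%:E.
Proof.
rewrite product_measure1E//= !lebesgue_measure_itv/= !lte_fin ab cd.
by rewrite -!EFinD -EFinM.
Qed.

(** Continuity is required on the whole plane, so the bound comes from the compact closure of the
    open rectangle. *)
Lemma continuous_bounded_rect f : continuous f ->
  exists2 M, 0 <= M & forall p, K p -> `|f p| <= M.
Proof.
move=> cf.
have cK : compact (`[a, b]%classic `*` `[c, d]%classic : set (R * R)).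
  by apply: compact_setX; exact: segment_compact.
have [] := @compact_EVT_max _ R (fun p => `|f p|) _ _ cK.
- exists (a, c); split; rewrite /= in_itv/= lexx ltW//.
- apply: continuous_subspaceT => p; apply: continuous_comp; first exact: cf.
  exact: norm_continuous.
move=> p0 Kp0 h; exists `|f p0| => // p [p1 p2]; apply: h.
by rewrite inE; split; apply: subset_itv_oo_cc.
Qed.

Lemma bounded_integrable_rect (f : R * R -> R) (M : R) : measurable_fun K f ->
  (forall p, K p -> `|f p| <= M) -> integrable2 K f.
Proof.
move=> mf fM; rewrite /integrable2 /lebesgue2.
apply: measurable_bounded_integrable.
- exact: measurable_rect.
- by rewrite [ltLHS]lebesgue2_rect ltry.
- exact: mf.
- exists M; split; first exact: num_real.
  by move=> x Mx p Kp; exact: le_trans (fM p Kp) (ltW Mx).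
Qed.

Lemma continuous_integrable_rect f : continuous f ->
  integrable2 K f.
Proof.
move=> cf; have [M _ fM] := continuous_bounded_rect cf.
apply: (bounded_integrable_rect (M := M)) => //.
by apply: continuous_measurable2 => //; exact: measurable_rect.
Qed.

Lemma integral2_iterated f : continuous f ->
  integral2 K f = (\int[mu]_(x in `]a, b[) \int[mu]_(y in `]c, d[) f (x, y))%R.
Proof.
move=> cf; have iK := continuous_integrable_rect cf.
rewrite /integral2 /Rintegral; congr fine.
have mK := measurable_rect.
(* Fubini is applied on the full product: the integrand is extended by zero outside the rectangle,
   and each section is restricted again afterwards. *)
rewrite integral_mkcond.
have iT : (mu \x mu)%E.-integrable setT ((EFin \o f) \_ K).
  by apply/(integrable_mkcond (mu := (mu \x mu)%E) (EFin \o f)).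
transitivity (\int[mu]_x fubini_F mu ((EFin \o f) \_ K) x)%E.
  by rewrite (integral12_prod_meas1 iT).
rewrite [RHS]integral_mkcond; apply: eq_integral => x _.
rewrite /fubini_F patchE; case: ifPn => xab.
  rewrite [LHS](_ : _ = \int[mu]_(y in `]c, d[) (f (x, y))%:E)%E; last first.
    rewrite [RHS]integral_mkcond; apply: eq_integral => y _.
    by rewrite !patchE /rect in_setX xab.
  rewrite fineK//; apply: integrable_fin_num; first exact: measurable_itv.
  by apply: (@continuous_integrable_itv R (fun y => f (x, y)) c d);
     exact: continuous_pairr.
by apply: integral0_eq => y _; rewrite patchE /rect in_setX (negbTE xab).
Qed.

Lemma integral2_iteratedC f : continuous f ->
  integral2 K f = (\int[mu]_(y in `]c, d[) \int[mu]_(x in `]a, b[) f (x, y))%R.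
Proof.
move=> cf; have iK := continuous_integrable_rect cf.
rewrite /integral2 /Rintegral; congr fine.
have mK := measurable_rect.
rewrite integral_mkcond.
have iT : (mu \x mu)%E.-integrable setT ((EFin \o f) \_ K).
  by apply/(integrable_mkcond (mu := (mu \x mu)%E) (EFin \o f)).
transitivity (\int[mu]_x fubini_G mu ((EFin \o f) \_ K) x)%E.
  by rewrite (integral21_prod_meas1 iT).
rewrite [RHS]integral_mkcond; apply: eq_integral => y _.
rewrite /fubini_G patchE; case: ifPn => ycd.
  rewrite [LHS](_ : _ = \int[mu]_(x in `]a, b[) (f (x, y))%:E)%E; last first.
    rewrite [RHS]integral_mkcond; apply: eq_integral => x _.
    by rewrite !patchE /rect in_setX ycd andbT.
  rewrite fineK//; apply: integrable_fin_num; first exact: measurable_itv.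
  by apply: (@continuous_integrable_itv R (fun x => f (x, y)) a b);
     exact: continuous_pairl.
by apply: integral0_eq => x _; rewrite patchE /rect in_setX (negbTE ycd) andbF.
Qed.

Lemma integral2_tensor (f g : R -> R) : continuous f -> continuous g ->
  integral2 K (fun p => f p.1 * g p.2) =
  (\int[mu]_(x in `]a, b[) f x)%R * (\int[mu]_(y in `]c, d[) g y)%R.
Proof.
move=> cf cg; rewrite integral2_iterated; last first.
  by move=> p; apply: cvgM; [apply: (continuous_comp _ (cf _))|
    apply: (continuous_comp _ (cg _))]; [exact: cvg_fst|exact: cvg_snd].
under eq_Rintegral => x _ /=.
  rewrite RintegralZl; [|exact: measurable_itv|exact: continuous_integrable_itv].
  over.
by rewrite RintegralZr; [|exact: measurable_itv|exact: continuous_integrable_itv].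
Qed.

Lemma integrable2D f g : integrable2 K f -> integrable2 K g ->
  integrable2 K (fun p => f p + g p).
Proof.
move=> fi gi; apply: (integrableD (mu := (mu \x mu)%E) _ fi gi).
exact: measurable_rect.
Qed.

Lemma integrable2Z (k : R) f : integrable2 K f -> integrable2 K (fun p => k * f p).
Proof.
move=> fi; apply: (integrableZl (mu := (mu \x mu)%E) _ k fi).
exact: measurable_rect.
Qed.

Lemma le_integrable2 f g : measurable_fun K f -> integrable2 K g ->
  (forall p, K p -> `|f p| <= g p) -> integrable2 K f.
Proof.
move=> mf gi fg; apply: (le_integrable (mu := (mu \x mu)%E) _ _ _ gi).
- exact: measurable_rect.
- exact/measurable_EFinP.
- by move=> p Kp; rewrite !abse_EFin lee_fin (le_trans (fg p Kp))// ler_norm.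
Qed.

Lemma integral2D f g : integrable2 K f -> integrable2 K g ->
  integral2 K (fun p => f p + g p) = integral2 K f + integral2 K g.
Proof.
move=> fi gi; apply: (RintegralD (mu := (mu \x mu)%E) _ fi gi).
exact: measurable_rect.
Qed.

Lemma integral2Z (k : R) f : integrable2 K f ->
  integral2 K (fun p => k * f p) = k * integral2 K f.
Proof.
move=> fi; apply: (RintegralZl (mu := (mu \x mu)%E) k _ fi).
exact: measurable_rect.
Qed.

Lemma integral2_cst k : integral2 K (fun=> k) = k * ((b - a) * (d - c)).
Proof.
rewrite /integral2 [LHS](Rintegral_cst (mu \x mu)%E measurable_rect) /=.
by congr (_ * _); rewrite -[RHS]/(fine _%:E) -lebesgue2_rect.
Qed.

Lemma le_integral2 f g : integrable2 K f -> integrable2 K g ->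
  (forall p, K p -> f p <= g p) -> integral2 K f <= integral2 K g.
Proof.
move=> fi gi fg; apply: (le_Rintegral (mu := (mu \x mu)%E) _ fi gi fg).
exact: measurable_rect.
Qed.

Lemma integral2_ge0 f : (forall p, K p -> 0 <= f p) -> 0 <= integral2 K f.
Proof. by move=> f0; apply: Rintegral_ge0. Qed.

End RectangleIntegral.

Lemma FTC_itv (R : realType) (F f : R -> R) (a b : R) : a < b ->
  (forall x, is_derive x (1 : R) F (f x)) -> continuous f ->
  (\int[@lebesgue_measure R]_(x in `]a, b[) f x)%R = F b - F a.
Proof.
move=> ab dF cf.
have cF : continuous F.
  move=> x; apply: differentiable_continuous; apply/derivable1_diffP.
  by have [] := dF x.
have cab : @integrable _ (measurableTypeR R) R (@lebesgue_measure R)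
    `[a, b]%classic (EFin \o f).
  apply: continuous_compact_integrable; first exact: segment_compact.
  exact: continuous_subspaceT.
rewrite Rintegral_itv_obnd_cbnd; last exact: continuous_integrable_itv.
rewrite Rintegral_itv_bndo_bndc; last first.
  apply: (integrableS _ _ _ cab); [exact: measurable_itv|exact: measurable_itv|].
  exact: subset_itv_co_cc.
rewrite /Rintegral (continuous_FTC2 (F := F) ab)//.
- exact: continuous_subspaceT.
- split=> [x _||]; first by have [] := dF x.
  + exact: cvg_at_right_filter (cF _).
  + exact: cvg_at_left_filter (cF _).
- by move=> x _; rewrite derive1E; have [] := dF x.
Qed.

(** * Partial derivatives *)

Lemma is_derive_mul (R : realType) (V : normedModType R) (f g : V -> R) x v df dg :
  is_derive x v f df -> is_derive x v g dg ->
  is_derive x v (fun p => f p * g p) (df * g x + f x * dg).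
Proof.
move=> d1 d2; have d3 := is_deriveM d1 d2.
apply: (@is_derive_eq _ _ _ (f * g) _ _ _ _ d3).
by rewrite /GRing.scale/= addrC mulrC.
Qed.

Section PartialDerivatives.
Context (R : realType).
Implicit Types (f g : R * R -> R) (p : R * R).

(** The difference quotients agree as functions, so one-variable results such as the mean value
    theorem transfer to partial derivatives in both directions. *)
Lemma derive_quotient_e1 f p :
  (fun h => h^-1 *: ((f \o shift p) (h *: e1 R) - f p)) =
  (fun h => h^-1 *: (((fun t => f (t, p.2)) \o shift p.1) (h *: 1) - f (p.1, p.2))).
Proof.
apply/funext => h /=; rewrite -surjective_pairing; congr (_ *: (f _ - _)).
by case: p => x y; congr (_, _); rewrite /= /GRing.scale/= mulr0 add0r.
Qed.

Lemma derive_quotient_e2 f p :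
  (fun h => h^-1 *: ((f \o shift p) (h *: e2 R) - f p)) =
  (fun h => h^-1 *: (((fun t => f (p.1, t)) \o shift p.2) (h *: 1) - f (p.1, p.2))).
Proof.
apply/funext => h /=; rewrite -surjective_pairing; congr (_ *: (f _ - _)).
by case: p => x y; congr (_, _); rewrite /= /GRing.scale/= mulr0 add0r.
Qed.

Lemma is_derive_e1 f p l :
  is_derive p (e1 R) f l <-> is_derive p.1 (1 : R) (fun t => f (t, p.2)) l.
Proof.
split=> [] [d1 d2]; apply: DeriveDef.
- by rewrite /derivable -derive_quotient_e1.
- by rewrite /derive -derive_quotient_e1.
- by rewrite /derivable derive_quotient_e1.
- by rewrite /derive derive_quotient_e1.
Qed.

Lemma is_derive_e2 f p l :
  is_derive p (e2 R) f l <-> is_derive p.2 (1 : R) (fun t => f (p.1, t)) l.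
Proof.
split=> [] [d1 d2]; apply: DeriveDef.
- by rewrite /derivable -derive_quotient_e2.
- by rewrite /derive -derive_quotient_e2.
- by rewrite /derivable derive_quotient_e2.
- by rewrite /derive derive_quotient_e2.
Qed.

(** A relational gradient: explicit partial derivatives are carried through sums and products
    without computing any ['D_v f]. *)
Definition has_grad f f1 f2 :=
  (forall p, is_derive p (e1 R) f (f1 p)) /\ (forall p, is_derive p (e2 R) f (f2 p)).

Lemma has_gradD f f1 f2 g g1 g2 : has_grad f f1 f2 -> has_grad g g1 g2 ->
  has_grad (fun p => f p + g p) (fun p => f1 p + g1 p) (fun p => f2 p + g2 p).
Proof. by move=> [d1 d2] [d3 d4]; split => p; apply: is_deriveD. Qed.

Lemma has_gradB f f1 f2 g g1 g2 : has_grad f f1 f2 -> has_grad g g1 g2 ->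
  has_grad (fun p => f p - g p) (fun p => f1 p - g1 p) (fun p => f2 p - g2 p).
Proof. by move=> [d1 d2] [d3 d4]; split => p; apply: is_deriveB. Qed.

Lemma has_gradM f f1 f2 g g1 g2 : has_grad f f1 f2 -> has_grad g g1 g2 ->
  has_grad (fun p => f p * g p) (fun p => f1 p * g p + f p * g1 p)
    (fun p => f2 p * g p + f p * g2 p).
Proof.
move=> [d1 d2] [d3 d4]; split => p.
- exact: is_derive_mul (d1 p) (d3 p).
- exact: is_derive_mul (d2 p) (d4 p).
Qed.

Lemma has_grad_tensor (f f' g g' : R -> R) :
  (forall x, is_derive x (1 : R) f (f' x)) ->
  (forall x, is_derive x (1 : R) g (g' x)) ->
  has_grad (fun p => f p.1 * g p.2) (fun p => f' p.1 * g p.2)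
    (fun p => f p.1 * g' p.2).
Proof.
move=> df dg; split => p; [apply/is_derive_e1 => /=|apply/is_derive_e2 => /=].
- rewrite -[X in is_derive _ _ _ X]addr0 -[X in _ + X](mulr0 (f p.1)).
  exact: is_derive_mul (df p.1) (is_derive_cst (g p.2) p.1 (1 : R)).
- rewrite -[X in is_derive _ _ _ X]add0r -[X in X + _](mul0r (g p.2)).
  exact: is_derive_mul (is_derive_cst (f p.1) p.2 (1 : R)) (dg p.2).
Qed.

(** Replaces the ['D] expressions of [Ck] by witnesses, after which closure under sums and products
    is an induction on the order. *)
Lemma CkS k f : Ck k.+1 f <-> continuous f /\
  exists f1 f2, [/\ has_grad f f1 f2, Ck k f1 & Ck k f2].
Proof.
split=> [[cf [d1 d2 C1 C2]]|[cf [f1 [f2 [[d1 d2] C1 C2]]]]]; split=> //.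
  exists (fun x => 'D_(e1 R) f x), (fun x => 'D_(e2 R) f x).
  by split => //; split => p; apply: DeriveDef.
have -> : (fun x => 'D_(e1 R) f x) = f1 by apply/funext => p; have [] := d1 p.
have -> : (fun x => 'D_(e2 R) f x) = f2 by apply/funext => p; have [] := d2 p.
by split.
Qed.

Lemma CkW k f : Ck k.+1 f -> Ck k f.
Proof.
elim: k f => [|k ih] f /CkS [cf [f1 [f2 [gf C1 C2]]]]; first by split.
by apply/CkS; split => //; exists f1, f2; split => //; apply: ih.
Qed.

Lemma CkD k f g : Ck k f -> Ck k g -> Ck k (fun p => f p + g p).
Proof.
elim: k f g => [|k ih] f g.
  by move=> [cf _] [cg _]; split=> // p; apply: cvgD; [exact: cf|exact: cg].
move=> /CkS [cf [f1 [f2 [gf C1 C2]]]] /CkS [cg [g1 [g2 [gg C3 C4]]]].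
apply/CkS; split; first by move=> p; apply: cvgD; [exact: cf|exact: cg].
exists (fun p => f1 p + g1 p), (fun p => f2 p + g2 p).
by split; [exact: has_gradD|exact: ih|exact: ih].
Qed.

Lemma CkM k f g : Ck k f -> Ck k g -> Ck k (fun p => f p * g p).
Proof.
elim: k f g => [|k ih] f g.
  by move=> [cf _] [cg _]; split=> // p; apply: cvgM; [exact: cf|exact: cg].
move=> /[dup] /CkW Cf /CkS [cf [f1 [f2 [gf C1 C2]]]].
move=> /[dup] /CkW Cg /CkS [cg [g1 [g2 [gg C3 C4]]]].
apply/CkS; split; first by move=> p; apply: cvgM; [exact: cf|exact: cg].
exists (fun p => f1 p * g p + f p * g1 p), (fun p => f2 p * g p + f p * g2 p).
by split; [exact: has_gradM|apply: CkD; exact: ih|apply: CkD; exact: ih].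
Qed.

(** The explicit exponentials, sines and cutoffs are tensor products of functions of this
    one-variable class; [Ck_tensor] carries them to the plane. *)
Fixpoint Ck1 (k : nat) (f : R -> R) : Prop :=
  if k is k'.+1 then
    exists2 f', forall x, is_derive x (1 : R) f (f' x) & Ck1 k' f'
  else continuous f.

Lemma derive_continuous (f f' : R -> R) :
  (forall x, is_derive x (1 : R) f (f' x)) -> continuous f.
Proof.
move=> df x; apply: differentiable_continuous; apply/derivable1_diffP.
by have [] := df x.
Qed.

Lemma Ck1_continuous k (f : R -> R) : Ck1 k f -> continuous f.
Proof. by case: k => //= k [f' df _]; exact: derive_continuous df. Qed.

Lemma Ck1W k (f : R -> R) : Ck1 k.+1 f -> Ck1 k f.
Proof.
elim: k f => [|k ih] f /= [f' df Cf']; first exact: derive_continuous df.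
by exists f' => //; exact: ih.
Qed.

Lemma Ck1D k (f g : R -> R) : Ck1 k f -> Ck1 k g -> Ck1 k (fun x => f x + g x).
Proof.
elim: k f g => [|k ih] f g.
  by move=> cf cg x; apply: cvgD; [exact: cf|exact: cg].
move=> [f' df Cf'] [g' dg Cg']; exists (fun x => f' x + g' x); last exact: ih.
by move=> x; apply: is_deriveD.
Qed.

Lemma Ck1M k (f g : R -> R) : Ck1 k f -> Ck1 k g -> Ck1 k (fun x => f x * g x).
Proof.
elim: k f g => [|k ih] f g.
  by move=> cf cg x; apply: cvgM; [exact: cf|exact: cg].
move=> /[dup] /Ck1W Cf [f' df Cf'] /[dup] /Ck1W Cg [g' dg Cg'].
exists (fun x => f' x * g x + f x * g' x); last by apply: Ck1D; exact: ih.
by move=> x; exact: is_derive_mul (df x) (dg x).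
Qed.

Lemma is_derive1_comp_fun (f f' g g' : R -> R) x :
  is_derive x (1 : R) g (g' x) -> is_derive (g x) (1 : R) f (f' (g x)) ->
  is_derive x (1 : R) (fun x => f (g x)) (f' (g x) * g' x).
Proof. by move=> dg df; apply: is_derive1_comp. Qed.

Lemma Ck1_comp k (f g : R -> R) : Ck1 k f -> Ck1 k g -> Ck1 k (fun x => f (g x)).
Proof.
elim: k f g => [|k ih] f g.
  by move=> cf cg x; apply: continuous_comp; [exact: cg|exact: cf].
move=> [f' df Cf'] /[dup] /Ck1W Cg [g' dg Cg'].
exists (fun x => f' (g x) * g' x); last by apply: Ck1M => //; exact: ih.
by move=> x; apply: is_derive1_comp_fun.
Qed.

Lemma Ck_tensor k (f g : R -> R) : Ck1 k f -> Ck1 k g ->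
  Ck k (fun p => f p.1 * g p.2).
Proof.
have ct (f0 g0 : R -> R) : continuous f0 -> continuous g0 ->
    continuous (fun p : R * R => f0 p.1 * g0 p.2).
  move=> cf cg p; apply: cvgM.
  - by apply: (continuous_comp _ (cf _)); exact: cvg_fst.
  - by apply: (continuous_comp _ (cg _)); exact: cvg_snd.
elim: k f g => [|k ih] f g; first by move=> cf cg; split => //; exact: ct.
move=> /[dup] /Ck1W Cf [f' df Cf'] /[dup] /Ck1W Cg [g' dg Cg'].
apply/CkS; split; first by apply: ct; [exact: Ck1_continuous Cf|exact: Ck1_continuous Cg].
exists (fun p => f' p.1 * g p.2), (fun p => f p.1 * g' p.2).
by split; [exact: has_grad_tensor|exact: ih|exact: ih].
Qed.

End PartialDerivatives.

(** * Sobolev norms on a rectangle *)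

Section SobolevRectangle.
Context (R : realType) (a b c d : R) (ab : a < b) (cd : c < d).
Local Notation K := (rect a b c d).
Implicit Types (u v g phi : R * R -> R).

Lemma inL2_1P u : inL2 K (cst 1) u <->
  measurable_fun K u /\ integrable2 K (fun p => u p ^+ 2).
Proof.
rewrite /inL2 -integrable2P; last exact: measurable_rect.
by under eq_fun do rewrite mul1r.
Qed.

Lemma L2norm_sq u : L2norm K (cst 1) u ^+ 2 = integral2 K (fun p => u p ^+ 2).
Proof.
rewrite /L2norm /L2inner sqr_sqrtr; last first.
  by apply: integral2_ge0 => p _; rewrite mul1r -expr2 sqr_ge0.
by under eq_fun do rewrite mul1r -expr2.
Qed.

Lemma inL2_continuous u : continuous u -> inL2 K (cst 1) u.
Proof.
move=> cu; apply/inL2_1P; split.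
  by apply: continuous_measurable2 => //; exact: measurable_rect.
apply: continuous_integrable_rect => // p.
exact: cvgM (cu p) (cu p).
Qed.

Lemma sqrD_le (x y : R) : (x + y) ^+ 2 <= 2 * x ^+ 2 + 2 * y ^+ 2.
Proof. by rewrite -subr_ge0 (_ : _ - _ = (x - y) ^+ 2) ?sqr_ge0//; ring. Qed.

Lemma inL2D u v : inL2 K (cst 1) u -> inL2 K (cst 1) v ->
  inL2 K (cst 1) (fun p => u p + v p).
Proof.
move=> /inL2_1P[mu iu] /inL2_1P[mv iv]; apply/inL2_1P.
have muv : measurable_fun K (fun p => u p + v p) by exact: measurable_funD.
split=> //; apply: (@le_integrable2 _ _ _ _ _ _
    (fun p => 2 * u p ^+ 2 + 2 * v p ^+ 2)) => //.
- exact: measurable_funX.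
- by apply: integrable2D; exact: integrable2Z.
- by move=> p _; rewrite ger0_norm ?sqr_ge0// sqrD_le.
Qed.

Lemma integral2_sqrD u v : inL2 K (cst 1) u -> inL2 K (cst 1) v ->
  integral2 K (fun p => (u p + v p) ^+ 2) <=
  2 * integral2 K (fun p => u p ^+ 2) + 2 * integral2 K (fun p => v p ^+ 2).
Proof.
move=> hu hv; have /inL2_1P[_ iuv] := inL2D hu hv.
move: hu hv => /inL2_1P[mu iu] /inL2_1P[mv iv].
rewrite -!integral2Z// -integral2D; [|exact: integrable2Z..].
apply: le_integral2 => //.
- by apply: integrable2D; exact: integrable2Z.
- by move=> p _; exact: sqrD_le.
Qed.

(** The pointwise bound |u g| <= u^2 + g^2 stands in for Cauchy-Schwarz and makes the integrands in
    [weak_derivative] integrable. *)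
Lemma inL2M_integrable u g : inL2 K (cst 1) u -> continuous g ->
  integrable2 K (fun p => u p * g p).
Proof.
move=> /inL2_1P[mu iu] cg.
apply: (@le_integrable2 _ _ _ _ _ _ (fun p => u p ^+ 2 + g p ^+ 2)) => //.
- apply: measurable_funM => //.
  by apply: continuous_measurable2 => //; exact: measurable_rect.
- apply: integrable2D => //.
  by have /inL2_1P[] := inL2_continuous cg.
- move=> p _; rewrite ler_norml; apply/andP; split; rewrite -subr_ge0.
    rewrite (_ : _ - _ = ((u p + g p) ^+ 2 + u p ^+ 2 + g p ^+ 2) / 2); last by field.
    by rewrite divr_ge0// !addr_ge0 ?sqr_ge0.
  rewrite (_ : _ - _ = ((u p - g p) ^+ 2 + u p ^+ 2 + g p ^+ 2) / 2); last by field.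
  by rewrite divr_ge0// !addr_ge0 ?sqr_ge0.
Qed.

(** The continuity of the derivatives of test functions is a hypothesis so that one proof covers
    both directions. *)
Lemma weak_derivativeD e u1 g1 u2 g2 :
  (forall phi, test_function K phi -> continuous (fun p => 'D_e phi p)) ->
  inL2 K (cst 1) u1 -> inL2 K (cst 1) g1 ->
  inL2 K (cst 1) u2 -> inL2 K (cst 1) g2 ->
  weak_derivative K e u1 g1 -> weak_derivative K e u2 g2 ->
  weak_derivative K e (fun p => u1 p + u2 p) (fun p => g1 p + g2 p).
Proof.
move=> cD Lu1 Lg1 Lu2 Lg2 w1 w2 phi tphi.
have cphi : continuous phi by have [/(_ 0%N) []] := tphi.
have cDphi := cD _ tphi.
under eq_fun do rewrite mulrDl.
under [in RHS]eq_fun do rewrite mulrDl.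
rewrite !integral2D; try exact: inL2M_integrable.
by rewrite w1// w2// opprD.
Qed.

Lemma test_function_grad phi : test_function K phi ->
  [/\ has_grad phi (fun p => 'D_(e1 R) phi p) (fun p => 'D_(e2 R) phi p),
      continuous (fun p => 'D_(e1 R) phi p) & continuous (fun p => 'D_(e2 R) phi p)].
Proof.
move=> [/(_ 1%N) [_ [d1 d2 [c1 _] [c2 _]]] _ _].
split; [|exact: c1|exact: c2].
by split => p; [exact: DeriveDef (d1 p) erefl|exact: DeriveDef (d2 p) erefl].
Qed.

Lemma test_function0 phi p : test_function K phi -> ~ K p -> phi p = 0.
Proof.
move=> [_ _ suppK] Kp; apply: contra_notP Kp => /eqP phip.
by apply: suppK; exact: subset_closure.
Qed.

(** The squared H^1 norm for a chosen weak gradient: sums and limits of squares involve no square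
    roots. *)
Definition H1sq u g1 g2 : R := integral2 K (fun p => u p ^+ 2) +
  integral2 K (fun p => g1 p ^+ 2) + integral2 K (fun p => g2 p ^+ 2).

Lemma is_H1normP u r : is_H1norm K u r <->
  exists g1 g2, H1_gradient K u g1 g2 /\ r = Num.sqrt (H1sq u g1 g2).
Proof.
by split=> -[g1 [g2 [G ->]]]; exists g1, g2; rewrite !L2norm_sq.
Qed.

(** The two forms match because eps is arbitrary: one direction is applied at the square root of
    eps, the other at eps^2. *)
Lemma H1_adherentP (A : set (R * R -> R)) u : H1_adherent K A u <->
  forall eps, 0 < eps -> exists w g1 g2,
    [/\ A w, H1_gradient K (fun x => u x - w x) g1 g2 &
        H1sq (fun x => u x - w x) g1 g2 < eps].
Proof.
split=> H eps eps0.
- have [|w [r [Aw /is_H1normP [g1 [g2 [G rE]]] re]]] := H (Num.sqrt eps).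
    by rewrite sqrtr_gt0.
  exists w, g1, g2; split => //.
  by move: re; rewrite rE ltr_sqrt.
- have [|w [g1 [g2 [Aw G re]]]] := H (eps ^+ 2); first by rewrite exprn_gt0.
  exists w, (Num.sqrt (H1sq (fun x => u x - w x) g1 g2)); split => //.
    by apply/is_H1normP; exists g1, g2.
  by rewrite -[ltRHS](ger0_norm (ltW eps0)) -sqrtr_sqr ltr_sqrt// exprn_gt0.
Qed.

Lemma H1_gradientD u u1 u2 v v1 v2 :
  H1_gradient K u u1 u2 -> H1_gradient K v v1 v2 ->
  H1_gradient K (fun p => u p + v p) (fun p => u1 p + v1 p) (fun p => u2 p + v2 p).
Proof.
move=> [Lu Lu1 Lu2 wu1 wu2] [Lv Lv1 Lv2 wv1 wv2]; split; try exact: inL2D.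
- by apply: weak_derivativeD => // phi /test_function_grad[].
- by apply: weak_derivativeD => // phi /test_function_grad[].
Qed.

Lemma H1sqD u u1 u2 v v1 v2 :
  H1_gradient K u u1 u2 -> H1_gradient K v v1 v2 ->
  H1sq (fun p => u p + v p) (fun p => u1 p + v1 p) (fun p => u2 p + v2 p) <=
  2 * H1sq u u1 u2 + 2 * H1sq v v1 v2.
Proof.
move=> [Lu Lu1 Lu2 _ _] [Lv Lv1 Lv2 _ _].
have := integral2_sqrD Lu Lv; have := integral2_sqrD Lu1 Lv1.
have := integral2_sqrD Lu2 Lv2; rewrite /H1sq; lra.
Qed.

Lemma H1_adherent_trans (A B : set (R * R -> R)) u :
  H1_adherent K A u -> (forall w, A w -> H1_adherent K B w) -> H1_adherent K B u.
Proof.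
move=> /H1_adherentP uA AB; apply/H1_adherentP => eps eps0.
(* [H1sqD] doubles each of the two squared errors, so each must be below a quarter of eps. *)
have e4 : 0 < eps / 4 by rewrite divr_gt0.
have [w [g1 [g2 [Aw G Gs]]]] := uA _ e4.
have /H1_adherentP/(_ _ e4)[w' [g1' [g2' [Bw' G' Gs']]]] := AB _ Aw.
have E : (fun x => (u x - w x) + (w x - w' x)) = (fun x => u x - w' x).
  by apply/funext => x; rewrite addrA subrK.
exists w', (fun p => g1 p + g1' p), (fun p => g2 p + g2' p); split => //.
  by rewrite -E; exact: H1_gradientD.
have := H1sqD G G'; rewrite E; lra.
Qed.

(** Along every line in the chosen direction the derivative of u phi integrates to zero, since phi
    vanishes at both ends. The inner integral is therefore taken over x for [e1] and over y for
    [e2]. *)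
Lemma C1_H1_gradient u u1 u2 : has_grad u u1 u2 ->
  continuous u -> continuous u1 -> continuous u2 -> H1_gradient K u u1 u2.
Proof.
move=> gu cu cu1 cu2; split; try exact: inL2_continuous.
- move=> phi tphi; have [gphi c1 c2] := test_function_grad tphi.
  have cphi : continuous phi by have [/(_ 0%N) []] := tphi.
  have [gw _] := has_gradM gu gphi.
  apply/eqP; rewrite -subr_eq0 opprK addrC -integral2D;
    [|exact: inL2M_integrable (inL2_continuous cu1) cphi
     |exact: inL2M_integrable (inL2_continuous cu) c1].
  rewrite integral2_iteratedC//; last first.
    by move=> p; apply: cvgD; apply: cvgM; [exact: cu1|exact: cphi|exact: cu|exact: c1].
  have inner0 y : (\int[@lebesgue_measure R]_(x in `]a, b[)
      (u1 (x, y) * phi (x, y) + u (x, y) * 'D_(e1 R) phi (x, y)))%R = 0.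
    have := @FTC_itv _ (fun x => u (x, y) * phi (x, y))
      (fun x => u1 (x, y) * phi (x, y) + u (x, y) * 'D_(e1 R) phi (x, y)) _ _ ab.
    rewrite !(test_function0 tphi) ?mulr0 ?subrr; last 2 first.
    - by move=> [/=]; rewrite !in_itv/= ltxx.
    - by move=> [/=]; rewrite !in_itv/= ltxx andbF.
    apply.
    - by move=> x; have /is_derive_e1 := gw (x, y).
    - apply: (@continuous_pairl _ (fun p => u1 p * phi p + u p * 'D_(e1 R) phi p)) => p.
      by apply: cvgD; apply: cvgM; [exact: cu1|exact: cphi|exact: cu|exact: c1].
  apply/eqP; under eq_Rintegral => y _.
    rewrite inner0.
    over.
  by rewrite Rintegral_cst ?mul0r//; exact: measurable_itv.
- move=> phi tphi; have [gphi c1 c2] := test_function_grad tphi.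
  have cphi : continuous phi by have [/(_ 0%N) []] := tphi.
  have [_ gw] := has_gradM gu gphi.
  apply/eqP; rewrite -subr_eq0 opprK addrC -integral2D;
    [|exact: inL2M_integrable (inL2_continuous cu2) cphi
     |exact: inL2M_integrable (inL2_continuous cu) c2].
  rewrite integral2_iterated//; last first.
    by move=> p; apply: cvgD; apply: cvgM; [exact: cu2|exact: cphi|exact: cu|exact: c2].
  have inner0 x : (\int[@lebesgue_measure R]_(y in `]c, d[)
      (u2 (x, y) * phi (x, y) + u (x, y) * 'D_(e2 R) phi (x, y)))%R = 0.
    have := @FTC_itv _ (fun y => u (x, y) * phi (x, y))
      (fun y => u2 (x, y) * phi (x, y) + u (x, y) * 'D_(e2 R) phi (x, y)) _ _ cd.
    rewrite !(test_function0 tphi) ?mulr0 ?subrr; last 2 first.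
    - by move=> [/=]; rewrite !in_itv/= ltxx.
    - by move=> [/=]; rewrite !in_itv/= ltxx andbF.
    apply.
    - by move=> y; have /is_derive_e2 := gw (x, y).
    - apply: (@continuous_pairr _ (fun p => u2 p * phi p + u p * 'D_(e2 R) phi p)) => p.
      by apply: cvgD; apply: cvgM; [exact: cu2|exact: cphi|exact: cu|exact: c2].
  apply/eqP; under eq_Rintegral => x _.
    rewrite inner0.
    over.
  by rewrite Rintegral_cst ?mul0r//; exact: measurable_itv.
Qed.

End SobolevRectangle.

(** * Approximation by cosine sums *)

(** The Bernstein polynomial with node values f 0, ..., f n, in the de Casteljau form: a binomial
    mean conditioned on the first trial. No binomial coefficients occur, and the moments below are
    plain inductions. *)
Fixpoint bern (R : realType) (n : nat) (f : nat -> R) (t : R) : R :=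
  if n is n'.+1 then (1 - t) * bern n' f t + t * bern n' (fun i => f i.+1) t
  else f 0%N.

Section Bernstein.
Context (R : realType).
Implicit Types (f g : nat -> R) (t s : R).

Lemma eq_bern n f g t : f =1 g -> bern n f t = bern n g t.
Proof.
elim: n f g => [|n ih] f g fg /=; first exact: fg.
by rewrite (ih f g fg) (ih (fun i => f i.+1) (fun i => g i.+1))// => i; exact: fg.
Qed.

Lemma bern_cst n (k t : R) : bern n (fun=> k) t = k.
Proof. by elim: n => //= n ->; ring. Qed.

Lemma bernD n f g t : bern n (fun i => f i + g i) t = bern n f t + bern n g t.
Proof. by elim: n f g => //= n ih f g; rewrite !ih; ring. Qed.

Lemma bernZ n k f t : bern n (fun i => k * f i) t = k * bern n f t.
Proof. by elim: n f => //= n ih f; rewrite !ih; ring. Qed.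

Lemma le_bern n f g t : 0 <= t <= 1 -> (forall i, (i <= n)%N -> f i <= g i) ->
  bern n f t <= bern n g t.
Proof.
move=> /andP[t0 t1]; elim: n f g => [|n ih] f g fg /=; first exact: fg.
rewrite lerD// ler_wpM2l ?subr_ge0// ih// => i ni; apply: fg => //.
exact: leqW.
Qed.

Lemma bern_id n t : bern n (fun i => i%:R) t = n%:R * t.
Proof.
elim: n => [|n ih] /=; first by rewrite mul0r.
under [X in _ + t * X]eq_bern do rewrite -natr1.
by rewrite bernD bern_cst ih -natr1; ring.
Qed.

Lemma bern_sqr n t : bern n (fun i => i%:R ^+ 2) t =
  n%:R * t * (1 - t) + (n%:R * t) ^+ 2.
Proof.
elim: n => [|n ih] /=; first by rewrite !mul0r expr0n addr0.
under [X in _ + t * X]eq_bern => i.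
  rewrite -natr1 (_ : _ ^+ 2 = i%:R ^+ 2 + (2 * i%:R + 1)); last by ring.
  over.
by rewrite !bernD bern_cst bernZ bern_id ih -natr1; ring.
Qed.

(** The exact value is t (1 - t) / n, the variance of a binomial frequency; the crude bound 1/n is
    enough. *)
Lemma bern_variance n t : 0 <= t <= 1 -> (0 < n)%N ->
  bern n (fun i => (i%:R / n%:R - t) ^+ 2) t <= n%:R^-1.
Proof.
move=> /andP[t0 t1] n0; have nR : n%:R != 0 :> R by rewrite pnatr_eq0 -lt0n.
rewrite (@eq_bern _ _ (fun i => (n%:R^-1) ^+ 2 * i%:R ^+ 2 +
  ((- (2 * t / n%:R)) * i%:R + t ^+ 2))); last by move=> i; field.
rewrite !bernD !bernZ bern_cst bern_id bern_sqr.
rewrite [leLHS](_ : _ = n%:R^-1 * (t * (1 - t))); last by field.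
rewrite -[leRHS]mulr1 ler_wpM2l ?invr_ge0//.
by rewrite mulr_ile1// ?subr_ge0// gerBl.
Qed.

Definition bern2 n (F : nat -> nat -> R) s t :=
  bern n (fun i => bern n (F i) t) s.

(** A Korovkin-type argument: a positive operator that fixes constants turns a quadratic bound on
    the error into a variance, at most 1/n in each variable. *)
Lemma bern2_approx n (F : nat -> nat -> R) s t v (e C : R) :
  0 <= s <= 1 -> 0 <= t <= 1 -> (0 < n)%N -> 0 <= C ->
  (forall i j, (i <= n)%N -> (j <= n)%N ->
    `|F i j - v| <= e + C * ((i%:R / n%:R - s) ^+ 2 + (j%:R / n%:R - t) ^+ 2)) ->
  `|bern2 n F s t - v| <= e + C * (2 / n%:R).
Proof.
move=> s01 t01 n0 C0 FC.
(* Taking S = 1 and S = -1 gives the two halves of the absolute value from one monotonicity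
   argument. *)
have aux (S : R) : `|S| <= 1 ->
   bern2 n (fun i j => S * (F i j - v)) s t <= e + C * (2 / n%:R).
  move=> S1.
  apply: (@le_trans _ _ (bern2 n (fun i j =>
    (e + C * (i%:R / n%:R - s) ^+ 2) + C * (j%:R / n%:R - t) ^+ 2) s t)).
    apply: le_bern => // i ni; apply: le_bern => // j nj.
    rewrite (le_trans (ler_norm _))// normrM.
    rewrite (le_trans (ler_piMl _ S1))// (le_trans (FC _ _ ni nj))//.
    by rewrite mulrDr addrA.
  rewrite /bern2.
  under eq_bern do rewrite bernD bern_cst bernZ.
  rewrite bernD bern_cst bernD bern_cst bernZ -addrA lerD2l -mulrDr ler_wpM2l//.
  rewrite (_ : 2 / n%:R = n%:R^-1 + n%:R^-1); last by rewrite mulrDl mul1r.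
  by apply: lerD; apply: bern_variance.
have E (S : R) : bern2 n (fun i j => S * (F i j - v)) s t =
    S * (bern2 n F s t - v).
  rewrite /bern2; under eq_bern do rewrite bernZ bernD bern_cst.
  by rewrite bernZ bernD bern_cst.
rewrite ler_norml; apply/andP; split.
- have := aux (-1); rewrite E normrN1 => /(_ (lexx _)); lra.
- by have := aux 1; rewrite E normr1 mul1r; apply.
Qed.

End Bernstein.

(* Off the compact set where [e <= H] the bound is trivial; on it, [D] is bounded
   away from [0]. *)
Lemma compact_modulus (T : topologicalType) (R : realType) (A : set T) (H D : T -> R) :
  compact A -> closed A -> continuous H -> continuous D ->
  (forall t, A t -> 0 <= D t) -> (forall t, A t -> D t = 0 -> H t <= 0) ->
  forall e, 0 < e -> exists2 C, 0 <= C & forall t, A t -> H t <= e + C * D t.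
Proof.
move=> cA clA cH cD D0 DH e e0.
pose B := A `&` [set t | e <= H t].
have cB : compact B.
  apply: (subclosed_compact _ cA); last by move=> t [].
  apply: closedI => //.
  apply: (@preimage_closed _ _ H [set x | e <= x]); last exact: closed_ge.
  by move=> t _; exact: cH.
have [B0|/set0P/negP/negPn/eqP B0] := pselect (B !=set0); last first.
  exists 0 => // t At; rewrite mul0r addr0 leNgt; apply/negP => /ltW eHt.
  by have : B t by []; rewrite B0.
have [] := @compact_EVT_max _ R H B B0 cB; first exact: continuous_subspaceT.
move=> t1; rewrite inE => -[At1 et1] maxH.
have [] := @compact_EVT_min _ R D B B0 cB; first exact: continuous_subspaceT.
move=> t0; rewrite inE => -[At0 et0] minD.
have Dt0 : 0 < D t0.
  rewrite lt_neqAle D0// andbT eq_sym; apply/eqP => /(DH _ At0).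
  by rewrite leNgt (lt_le_trans e0).
exists (H t1 / D t0); first by rewrite divr_ge0 ?ltW// (lt_le_trans e0).
move=> t At; have [Het|eHt] := leP (H t) e.
  rewrite (le_trans Het)// lerDl mulr_ge0 ?D0// divr_ge0 ?ltW//.
  exact: (lt_le_trans e0).
have Bt : t \in B by rewrite inE; split => //; exact: ltW.
have Ht1 : 0 <= H t1 by rewrite ltW// (lt_le_trans e0).
have DD : D t0 <= D t by exact: minD.
rewrite (le_trans (maxH _ Bt))// (@le_trans _ _ (H t1 / D t0 * D t))//.
  by rewrite -mulrA ler_peMr// mulrC ler_pdivlMr// mul1r.
by rewrite lerDr ltW.
Qed.

(** * Linear spans of sets of functions *)

Section LinearSpan.
Context (R : realType).
Implicit Types (F : set (R * R -> R)) (f g : R * R -> R).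

Lemma lin_span_gen F f : F f -> lin_span F f.
Proof.
move=> Ff; exists 1%N, (fun=> 1), (fun=> f); split => //.
by apply/funext => p; rewrite big_ord1 mul1r.
Qed.

Lemma lin_spanZ F f k : lin_span F f -> lin_span F (fun p => k * f p).
Proof.
move=> [n [c [fs [Ffs ->]]]]; exists n, (fun i => k * c i), fs; split => //.
by apply/funext => p; rewrite mulr_sumr; under [RHS]eq_bigr do rewrite -mulrA.
Qed.

Lemma lin_spanD F f g : lin_span F f -> lin_span F g ->
  lin_span F (fun p => f p + g p).
Proof.
move=> [n [c [fs [Ffs ->]]]] [m [d [gs [Fgs ->]]]].
exists (n + m)%N, (fun i => match fintype.split i with inl j => c j | inr j => d j end),
  (fun i => match fintype.split i with inl j => fs j | inr j => gs j end).
split; first by move=> i; case: (fintype.split i).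
apply/funext => p; rewrite big_split_ord/=; congr (_ + _); apply: eq_bigr => i _.
  by rewrite (unsplitK (inl i)).
by rewrite (unsplitK (inr i)).
Qed.

(** Generators enter already multiplied by a scalar, so Q need not be shown stable under scaling. *)
Lemma lin_span_ind F (Q : (R * R -> R) -> Prop) : Q (fun=> 0) ->
  (forall f g, Q f -> Q g -> Q (fun p => f p + g p)) ->
  (forall k f, F f -> Q (fun p => k * f p)) ->
  forall f, lin_span F f -> Q f.
Proof.
move=> Q0 QD QZ f [n [c [fs [Ffs ->]]]].
elim: n c fs Ffs => [|n ih] c fs Ffs.
  by rewrite (_ : (fun=> _) = (fun=> 0))//; apply/funext => p; rewrite big_ord0.
rewrite (_ : (fun=> _) = (fun p => \sum_(i < n) c (widen_ord (leqnSn n) i) *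
    fs (widen_ord (leqnSn n) i) p + c ord_max * fs ord_max p)); last first.
  by apply/funext => p; rewrite big_ord_recr.
apply: QD; last exact: QZ.
exact: (ih (fun i => c (widen_ord (leqnSn n) i)) (fun i => fs (widen_ord (leqnSn n) i))).
Qed.

End LinearSpan.

Definition cosx (R : realType) (a b : R) (j : nat) (x : R) : R :=
  cos (j%:R * pi / (b - a) * (x - b)).

Definition sinx (R : realType) (a b : R) (j : nat) (x : R) : R :=
  sin (j%:R * pi / (b - a) * (x - b)).

Section Cosines.
Context (R : realType) (a b : R) (ab : a < b).

Lemma cosx0 x : cosx a b 0 x = 1.
Proof. by rewrite /cosx !mul0r cos0. Qed.

(** The index j.+1 keeps the lower frequency j a natural number; a factor of frequency 0 is the
    constant 1 and is treated apart. *)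
Lemma cosxM1 j x : cosx a b j.+1 x * cosx a b 1 x =
  (cosx a b j.+2 x + cosx a b j x) / 2.
Proof.
rewrite /cosx; set u := 1%:R * pi / (b - a) * (x - b).
rewrite (_ : j.+2%:R * pi / (b - a) * (x - b) =
  j.+1%:R * pi / (b - a) * (x - b) + u); last first.
  by rewrite /u -[j.+2%:R]natr1; ring.
rewrite (_ : j%:R * pi / (b - a) * (x - b) = j.+1%:R * pi / (b - a) * (x - b) - u); last first.
  by rewrite /u -[j.+1%:R]natr1; ring.
by rewrite cosD cosB; field.
Qed.

(** The change of variable from [a, b] to [0, 1] in which the Bernstein operators act; it equals 0
    at a and 1 at b. *)
Definition xi (x : R) : R := (1 + cosx a b 1 x) / 2.

Lemma xi01 x : 0 <= xi x <= 1.
Proof.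
rewrite /xi; have := cos_geN1 (1%:R * pi / (b - a) * (x - b)).
have := cos_le1 (1%:R * pi / (b - a) * (x - b)); rewrite /cosx => h1 h2.
by apply/andP; split; lra.
Qed.

Lemma xi_inj : {in `[a, b]%classic &, injective xi}.
Proof.
have ba0 : 0 < b - a by rewrite subr_gt0.
(* As cos is even, x - b may be replaced by b - x, whose rescaling lies in [0, pi], where cos is
   injective. *)
have rg x : `[a, b]%classic x -> pi / (b - a) * (b - x) \in `[0, pi].
  rewrite /= !in_itv/= => /andP[ax xb]; apply/andP; split.
    by rewrite mulr_ge0 ?divr_ge0 ?pi_ge0 ?subr_ge0 ?(ltW ab).
  rewrite mulrAC ler_pdivrMr// ler_wpM2l ?pi_ge0// lerD2l lerN2//.
have xiE x : xi x = (1 + cos (pi / (b - a) * (b - x))) / 2.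
  by rewrite /xi /cosx mul1r -(opprB b x) mulrN cosN.
move=> x y; rewrite !inE => /rg xab /rg yab; rewrite !xiE => /eqP.
rewrite (inj_eq (mulIf _)) ?invr_eq0 ?pnatr_eq0// (inj_eq (addrI _)) => /eqP.
move=> /(cos_inj xab yab) /eqP; rewrite (inj_eq (mulfI _)); last first.
  by rewrite mulf_neq0 ?invr_eq0 ?gt_eqF ?pi_gt0.
by rewrite (inj_eq (addrI _)) eqr_opp => /eqP.
Qed.

Lemma xi_surj t : 0 <= t <= 1 -> exists2 x, `[a, b]%classic x & xi x = t.
Proof.
move=> /andP[t0 t1]; have t11 : -1 <= 2 * t - 1 <= 1 by apply/andP; split; lra.
have ba0 : 0 < b - a by rewrite subr_gt0.
have pi0 : 0 < pi :> R by exact: pi_gt0.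
have A0 := acos_ge0 t11; have Api := acos_lepi t11.
exists (b - (b - a) / pi * acos (2 * t - 1)).
  rewrite /= in_itv/= gerBl mulr_ge0 ?divr_ge0 ?(ltW ba0) ?(ltW pi0)// andbT.
  rewrite lerBrDl -lerBrDr mulrAC ler_pdivrMr// ler_wpM2l// ltW//.
rewrite /xi /cosx (_ : 1%:R * pi / (b - a) * _ = - acos (2 * t - 1)); last first.
  rewrite mul1r; move: (acos _) pi0 => T; move: (pi : R) => P P0.
  by field; rewrite !gt_eqF.
by rewrite cosN acosK ?in_itv//; field.
Qed.

Lemma continuous_cosx j : continuous (cosx a b j).
Proof.
move=> x; apply: continuous_comp; last exact: continuous_cos.
by apply: cvgM; [exact: cvg_cst|apply: cvgB; [exact: cvg_id|exact: cvg_cst]].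
Qed.

Lemma continuous_xi : continuous xi.
Proof.
move=> x; apply: cvgM; last exact: cvg_cst.
by apply: cvgD; [exact: cvg_cst|exact: continuous_cosx].
Qed.

End Cosines.

Section CosinePolynomials.
Context (R : realType) (a b c d : R) (ab : a < b) (cd : c < d).

Definition cosines : set (R * R -> R) := [set f | exists j s,
  f = (fun p => cosx a b j p.1 * cosx c d s p.2)].

(** The coefficients are functions rather than constants because the lemma is used twice: those of
    the outer polynomial in one variable are Bernstein polynomials in the other. *)
Lemma bern_closed (S : set (R * R -> R)) (z : R * R -> R) :
  (forall f g, S f -> S g -> S (fun p => f p + g p)) ->
  (forall f k, S f -> S (fun p => k * f p)) ->
  (forall f, S f -> S (fun p => z p * f p)) ->
  forall n (F : nat -> R * R -> R), (forall i, S (F i)) ->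
  S (fun p => bern n (fun i => F i p) (z p)).
Proof.
move=> SD SZ Sz; elim => [|n ih] F SF /=; first exact: SF.
have S1 := ih _ SF; have S2 := ih (fun i => F i.+1) (fun i => SF i.+1).
apply: (SD _ _ _ (Sz _ S2)).
have := SD _ _ S1 (SZ _ (-1) (Sz _ S1)); congr S.
by apply/funext => p; rewrite mulN1r mulrBl mul1r.
Qed.

Lemma cosines_closed_xi (f : R * R -> R) : lin_span cosines f ->
  lin_span cosines (fun p => xi a b p.1 * f p).
Proof.
apply: (lin_span_ind (Q := fun f => lin_span cosines (fun p => xi a b p.1 * f p))).
- have := @lin_spanZ _ cosines (fun p => cosx a b 0 p.1 * cosx c d 0 p.2) 0.
  rewrite (_ : (fun=> 0 * _) = (fun p => xi a b p.1 * 0)).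
    by apply; apply: lin_span_gen; exists 0%N, 0%N.
  by apply/funext => p; rewrite mul0r mulr0.
- move=> {}f g Sf Sg; have := lin_spanD Sf Sg; congr lin_span.
  by apply/funext => p; rewrite mulrDr.
- move=> k {}f [[|j] [s ->]].
    have h0 : lin_span cosines (fun p => cosx a b 0 p.1 * cosx c d s p.2).
      by apply: lin_span_gen; exists 0%N, s.
    have h1 : lin_span cosines (fun p => cosx a b 1 p.1 * cosx c d s p.2).
      by apply: lin_span_gen; exists 1%N, s.
    have := lin_spanD (lin_spanZ (k / 2) h0) (lin_spanZ (k / 2) h1).
    by congr lin_span; apply/funext => p; rewrite /xi cosx0; field.
  have h0 : lin_span cosines (fun p => cosx a b j p.1 * cosx c d s p.2).
    by apply: lin_span_gen; exists j, s.
  have h1 : lin_span cosines (fun p => cosx a b j.+1 p.1 * cosx c d s p.2).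
    by apply: lin_span_gen; exists j.+1, s.
  have h2 : lin_span cosines (fun p => cosx a b j.+2 p.1 * cosx c d s p.2).
    by apply: lin_span_gen; exists j.+2, s.
  have := lin_spanD (lin_spanD (lin_spanZ (k / 4) h0) (lin_spanZ (k / 2) h1))
    (lin_spanZ (k / 4) h2).
  congr lin_span; apply/funext => p; rewrite /xi.
  have E := cosxM1 a b j p.1.
  rewrite [RHS](_ : _ = k / 2 * cosx c d s p.2 *
    (cosx a b j.+1 p.1 + cosx a b j.+1 p.1 * cosx a b 1 p.1)); last by field.
  by rewrite E; field.
Qed.

End CosinePolynomials.

(** Exchanging the coordinates reduces this to [cosines_closed_xi]. *)
Lemma cosines_closed_eta (R : realType) (a b c d : R) (f : R * R -> R) :
  lin_span (cosines a b c d) f ->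
  lin_span (cosines a b c d) (fun p => xi c d p.2 * f p).
Proof.
pose sw (p : R * R) := (p.2, p.1).
have swap a' b' c' d' g : lin_span (cosines a' b' c' d') g ->
    lin_span (cosines c' d' a' b') (g \o sw).
  move=> [n [k [fs [Ffs ->]]]]; exists n, k, (fun i => fs i \o sw); split => // i.
  by have [j [s ->]] := Ffs i; exists s, j; apply/funext => p; rewrite /= mulrC.
by move=> /swap /cosines_closed_xi /swap; congr lin_span; apply/funext => -[].
Qed.

Lemma cosine_approx (R : realType) (a b c d : R) (f : R * R -> R) (e : R) :
  a < b -> c < d -> continuous f -> 0 < e ->
  exists2 P, lin_span (cosines a b c d) P &
    forall p, (`[a, b]%classic `*` `[c, d]%classic) p -> `|f p - P p| <= e.
Proof.
move=> ab cd cf e0.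
pose A : set (R * R) := `[a, b]%classic `*` `[c, d]%classic.
have cA : compact A by apply: compact_setX; exact: segment_compact.
have cAA : compact (A `*` A) by exact: compact_setX.
have clAA : closed (A `*` A) by apply: compact_closed => //; exact: norm_hausdorff.
(* Distances are measured through [xi], so that D is the quadratic deviation which [bern2_approx]
   can average. Since [xi] is injective on each side, D vanishes only on the diagonal, as
   [compact_modulus] requires. *)
pose D (t : (R * R) * (R * R)) := (xi a b t.1.1 - xi a b t.2.1) ^+ 2 +
  (xi c d t.1.2 - xi c d t.2.2) ^+ 2.
pose H (t : (R * R) * (R * R)) := `|f t.1 - f t.2|.
have cH : continuous H.
  move=> t; apply: cvg_norm; apply: cvgB.
  - by apply: (continuous_comp _ (cf _)); exact: cvg_fst.
  - by apply: (continuous_comp _ (cf _)); exact: cvg_snd.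
have cD : continuous D.
  have cvgsq (u v : (R * R) * (R * R) -> R) t : {for t, continuous u} ->
      {for t, continuous v} -> {for t, continuous (fun t => (u t - v t) ^+ 2)}.
    by move=> cu cv; exact: cvgM (cvgB cu cv) (cvgB cu cv).
  move=> t; apply: cvgD; apply: cvgsq.
  - apply: (continuous_comp (f := fun t : (R * R) * (R * R) => t.1.1) (g := xi a b)).
      exact: cvg_comp cvg_fst cvg_fst.
    exact: continuous_xi.
  - apply: (continuous_comp (f := fun t : (R * R) * (R * R) => t.2.1) (g := xi a b)).
      exact: cvg_comp cvg_snd cvg_fst.
    exact: continuous_xi.
  - apply: (continuous_comp (f := fun t : (R * R) * (R * R) => t.1.2) (g := xi c d)).
      exact: cvg_comp cvg_fst cvg_snd.
    exact: continuous_xi.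
  - apply: (continuous_comp (f := fun t : (R * R) * (R * R) => t.2.2) (g := xi c d)).
      exact: cvg_comp cvg_snd cvg_snd.
    exact: continuous_xi.
have D0 t : (A `*` A) t -> 0 <= D t by move=> _; rewrite addr_ge0 ?sqr_ge0.
have DH t : (A `*` A) t -> D t = 0 -> H t <= 0.
  move: t => [[x y] [x' y']] [[/= Ax Ay] [Ax' Ay']] /eqP.
  rewrite /D/= paddr_eq0 ?sqr_ge0// !sqrf_eq0 !subr_eq0 => /andP[/eqP xx /eqP yy].
  rewrite /H/= (xi_inj ab _ _ xx) ?inE// (xi_inj cd _ _ yy) ?inE//.
  by rewrite subrr normr0.
have e2 : 0 < e / 2 by rewrite divr_gt0.
have [C C0 HC] := compact_modulus cAA clAA cH cD D0 DH e2.
have [n n0 nC] : exists2 n, (0 < n)%N & C * (2 / n%:R) <= e / 2.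
  exists (Num.truncn (4 * C / e)).+1 => //.
  rewrite mulrA ler_pdivrMr// -ler_pdivrMl//.
  rewrite (_ : (e / 2)^-1 * (C * 2) = 4 * C / e); last by field; rewrite gt_eqF.
  by rewrite ltW// truncnS_gt.
(* The sample points are the preimages of i / n. Beyond n the point is a dummy that an operator of
   degree n never reads. *)
have smp (a' b' : R) (i : nat) : a' < b' -> exists x, (i <= n)%N ->
    `[a', b']%classic x /\ xi a' b' x = i%:R / n%:R.
  move=> ab'; have [ni|ni] := leqP i n; last by exists 0.
  have [|x abx xE] := @xi_surj _ _ _ ab' (i%:R / n%:R); last by exists x.
  by rewrite divr_ge0//= ler_pdivrMr ?ltr0n// mul1r ler_nat.
have [X hX] := choice (fun i => smp a b i ab).
have [Y hY] := choice (fun i => smp c d i cd).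
exists (fun p => bern2 n (fun i j => f (X i, Y j)) (xi a b p.1) (xi c d p.2)).
  apply: (@bern_closed _ (lin_span (cosines a b c d)) (fun p => xi a b p.1)
    _ _ _ n (fun i p => bern n (fun j => f (X i, Y j)) (xi c d p.2))) => [| | |i].
  - exact: lin_spanD.
  - by move=> g k; exact: lin_spanZ.
  - exact: cosines_closed_xi.
  apply: (@bern_closed _ (lin_span (cosines a b c d)) (fun p => xi c d p.2)
    _ _ _ n (fun j p => f (X i, Y j))) => [| | |j].
  - exact: lin_spanD.
  - by move=> g k; exact: lin_spanZ.
  - exact: cosines_closed_eta.
  have h1 : lin_span (cosines a b c d) (fun=> 1).
    by apply: lin_span_gen; exists 0%N, 0%N; apply/funext => p; rewrite !cosx0 mulr1.
  by have := lin_spanZ (f (X i, Y j)) h1; congr lin_span; apply/funext => p; rewrite mulr1.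
move=> p [pab pcd]; rewrite distrC.
have -> : e = e / 2 + e / 2 by field.
rewrite (le_trans (bern2_approx (e := e / 2) _ _ n0 C0 _))//; [exact: xi01|exact: xi01| |].
  move=> i j /hX[Xi xiX] /hY[Yj xiY].
  rewrite -xiX -xiY; exact: (HC ((X i, Y j), p)).
by rewrite lerD2l.
Qed.

(** * Approximation by sine sums *)

Section SineApproximation.
Context (R : realType).
Implicit Types (p : R * R).

Lemma lin_span0 (F : set (R * R -> R)) : lin_span F (fun=> 0).
Proof.
exists 0%N, (fun=> 0), (fun=> (fun=> 0)); split; first by case.
by apply/funext => p; rewrite big_ord0.
Qed.

Lemma sin_natpi j : sin (j%:R * pi) = 0 :> R.
Proof.
elim: j => [|j ih]; first by rewrite mul0r sin0.
by rewrite -natr1 mulrDl mul1r sinDpi ih oppr0.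
Qed.

Lemma sinx_left (a b : R) j : a < b -> sinx a b j a = 0.
Proof.
move=> ab; rewrite /sinx (_ : _ * (a - b) = - (j%:R * pi)); last first.
  rewrite -(opprB b a) mulrN divfK// subr_eq0 gt_eqF//.
by rewrite sinN sin_natpi oppr0.
Qed.

Lemma sinx_right (a b : R) j : sinx a b j b = 0.
Proof. by rewrite /sinx subrr mulr0 sin0. Qed.

Lemma is_derive_affine (k m x : R) : is_derive x (1 : R) (fun t => k * (t - m)) k.
Proof.
have h : is_derive x (1 : R) (fun t => t - m) 1.
  rewrite -[X in is_derive _ _ _ X]subr0; exact: is_deriveB.
have := is_derive_mul (is_derive_cst k x (1 : R)) h.
by rewrite mul0r add0r mulr1.
Qed.

Lemma is_derive_sinx (a b : R) j x : is_derive x (1 : R) (sinx a b j)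
  (j%:R * pi / (b - a) * cosx a b j x).
Proof.
rewrite mulrC; apply: (is_derive1_comp_fun (f' := cos) (g' := fun=> _)) (is_derive_affine _ _ _) _.
Qed.

Lemma is_derive_cosx (a b : R) j x : is_derive x (1 : R) (cosx a b j)
  (- (j%:R * pi / (b - a) * sinx a b j x)).
Proof.
rewrite mulrC -mulNr.
apply: (is_derive1_comp_fun (f' := fun x => - sin x) (g' := fun=> _)) (is_derive_affine _ _ _) _.
Qed.

(* The antiderivative of [cosx a b j] that vanishes at [a]. *)
Definition sinprim (a b : R) (j : nat) (x : R) : R :=
  if j == 0%N then x - a else (j%:R * pi / (b - a))^-1 * sinx a b j x.

Lemma is_derive_sinprim (a b : R) j x : a < b ->
  is_derive x (1 : R) (sinprim a b j) (cosx a b j x).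
Proof.
move=> ab; case: j => [|j].
  rewrite cosx0 /sinprim/=; have := is_derive_affine 1 a x.
  by under eq_fun do rewrite mul1r.
rewrite /sinprim/=.
have := is_derive_mul (is_derive_cst (j.+1%:R * pi / (b - a))^-1 x (1 : R))
  (is_derive_sinx a b j.+1 x).
rewrite mul0r add0r mulKf//.
by rewrite mulf_neq0 ?invr_eq0 ?subr_eq0 ?gt_eqF ?mulr_gt0 ?pi_gt0.
Qed.

Lemma sinprim_left (a b : R) j : a < b -> sinprim a b j a = 0.
Proof.
by move=> ab; rewrite /sinprim; case: ifP; rewrite ?subrr// sinx_left// mulr0.
Qed.

(** Subtracting the chord kills the linear primitive of the constant and leaves the sines unchanged,
    since they vanish at b. On a tensor product, [correct] is the product of these one-variable
    operations. *)
Lemma sinprim_correction (a b : R) j x : a < b ->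
  sinprim a b j x - (x - a) / (b - a) * sinprim a b j b =
  if j == 0%N then 0 else sinprim a b j x.
Proof.
move=> ab; rewrite /sinprim; case: ifP => _.
  by rewrite divfK ?subrr// subr_eq0 gt_eqF.
by rewrite sinx_right !mulr0 subr0.
Qed.

Definition sines (a b c d : R) : set (R * R -> R) := [set f | exists j s,
  [/\ (0 < j)%N, (0 < s)%N & f = (fun p => sinx a b j p.1 * sinx c d s p.2)]].

(* Subtracting from [U] its bilinear interpolation on the right and upper sides. *)
Definition correct (a b c d : R) (U : R * R -> R) (p : R * R) : R :=
  U p - (p.1 - a) / (b - a) * U (b, p.2) - (p.2 - c) / (d - c) * U (p.1, d)
  + (p.1 - a) / (b - a) * ((p.2 - c) / (d - c)) * U (b, d).

(** U is a double primitive of P. Its vanishing conditions are shared by every function that is zero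
    outside the rectangle, so that differences can be integrated from the sides x = a and y = c. *)
Definition primitive2 (a b c d : R) (P U U1 U2 : R * R -> R) :=
  [/\ has_grad U U1 U2, (forall p, is_derive p (e2 R) U1 (P p)),
      (forall p, is_derive p (e1 R) U2 (P p)) &
      [/\ continuous U, continuous U1, continuous U2, continuous P &
      [/\ forall y, U (a, y) = 0, forall y, U2 (a, y) = 0, forall x, U1 (x, c) = 0
      & lin_span (sines a b c d) (correct a b c d U)]]].

Lemma continuous_tensor (f0 g0 : R -> R) : continuous f0 -> continuous g0 ->
  continuous (fun p : R * R => f0 p.1 * g0 p.2).
Proof. by move=> cf cg; have [] := @Ck_tensor R 0 f0 g0 cf cg. Qed.

Lemma is_derive_scale (V : normedModType R) (f : V -> R) x v df (k : R) :
  is_derive x v f df -> is_derive x v (fun y => k * f y) (k * df).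
Proof.
move=> h; have := is_derive_mul (is_derive_cst k x v) h.
by rewrite mul0r add0r.
Qed.

Lemma continuous_scale (T : topologicalType) (f : T -> R) k :
  continuous f -> continuous (fun x => k * f x).
Proof. by move=> cf x; apply: cvgM; [exact: cvg_cst|exact: cf]. Qed.

Lemma continuous_add (T : topologicalType) (f g : T -> R) :
  continuous f -> continuous g -> continuous (fun x => f x + g x).
Proof. by move=> cf cg x; apply: cvgD; [exact: cf|exact: cg]. Qed.

Lemma continuous_sub (T : topologicalType) (f g : T -> R) :
  continuous f -> continuous g -> continuous (fun x => f x - g x).
Proof. by move=> cf cg x; apply: cvgB; [exact: cf|exact: cg]. Qed.

Lemma continuous_mul (T : topologicalType) (f g : T -> R) :
  continuous f -> continuous g -> continuous (fun x => f x * g x).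
Proof. by move=> cf cg x; apply: cvgM; [exact: cf|exact: cg]. Qed.

Lemma cosines_primitive2 (a b c d : R) P : a < b -> c < d ->
  lin_span (cosines a b c d) P -> exists U U1 U2, primitive2 a b c d P U U1 U2.
Proof.
move=> ab cd; apply: (lin_span_ind (Q := fun P => exists U U1 U2, primitive2 a b c d P U U1 U2)).
- have d0 p (v : R * R) : is_derive p v ((fun=> 0) : R * R -> R) 0 by exact: is_derive_cst.
  have c0 : continuous ((fun=> 0) : R * R -> R) by move=> p; exact: cvg_cst.
  exists (fun=> 0), (fun=> 0), (fun=> 0); split => //; split => //; split => //.
  rewrite (_ : correct _ _ _ _ _ = (fun=> 0)); first exact: lin_span0.
  by apply/funext => p; rewrite /correct; ring.
- move=> f g [U [U1 [U2 [[gU gU'] dU1 dU2 [cU cU1 cU2 cf [z1 z2 z3 sU]]]]]].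
  move=> [V [V1 [V2 [[gV gV'] dV1 dV2 [cV cV1 cV2 cg [z4 z5 z6 sV]]]]]].
  exists (fun p => U p + V p), (fun p => U1 p + V1 p), (fun p => U2 p + V2 p).
  split; [by apply: has_gradD|by move=> p; apply: is_deriveD|by move=> p; apply: is_deriveD|].
  split; try exact: continuous_add; split.
  + by move=> y; rewrite z1 z4 addr0.
  + by move=> y; rewrite z2 z5 addr0.
  + by move=> y; rewrite z3 z6 addr0.
  + have := lin_spanD sU sV; congr lin_span; apply/funext => p.
    by rewrite /correct; ring.
- move=> k f [j [s ->]].
  have [dj ds] : (forall x, is_derive x (1 : R) (sinprim a b j) (cosx a b j x)) /\
      (forall x, is_derive x (1 : R) (sinprim c d s) (cosx c d s x)).
    by split => x; exact: is_derive_sinprim.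
  have [cj cs] := (derive_continuous dj, derive_continuous ds).
  have [cj' cs'] := (@continuous_cosx R a b j, @continuous_cosx R c d s).
  exists (fun p => k * (sinprim a b j p.1 * sinprim c d s p.2)),
    (fun p => k * (cosx a b j p.1 * sinprim c d s p.2)),
    (fun p => k * (sinprim a b j p.1 * cosx c d s p.2)).
  have [g1 g2] := has_grad_tensor dj ds.
  split.
  + by split => p; apply: is_derive_scale.
  + have [_ h] := has_grad_tensor (is_derive_cosx a b j) ds.
    by move=> p; apply: is_derive_scale.
  + have [h _] := has_grad_tensor dj (is_derive_cosx c d s).
    by move=> p; apply: is_derive_scale.
  + split; try by apply: continuous_scale; exact: continuous_tensor.
    split => /= [y|y|x|]; rewrite ?sinprim_left ?mul0r ?mulr0//.
    rewrite (_ : correct _ _ _ _ _ = (fun p => k *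
        ((if j == 0%N then 0 else sinprim a b j p.1) *
         (if s == 0%N then 0 else sinprim c d s p.2)))); last first.
      apply/funext => p; rewrite -!sinprim_correction// /correct/=; ring.
    apply: lin_spanZ; case: j s {dj ds cj cs cj' cs' g1 g2} => [|j] [|s] /=;
      under eq_fun do rewrite ?mul0r ?mulr0; try exact: lin_span0.
    have := @lin_spanZ _ (sines a b c d) (fun p => sinx a b j.+1 p.1 * sinx c d s.+1 p.2)
      ((j.+1%:R * pi / (b - a))^-1 * (s.+1%:R * pi / (d - c))^-1).
    rewrite (_ : (fun p => _ * _ * _) =
      (fun p => sinprim a b j.+1 p.1 * sinprim c d s.+1 p.2)).
      by apply; apply: lin_span_gen; exists j.+1, s.+1.
    by apply/funext => p; rewrite /sinprim/= mulrACA.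
Qed.

Lemma bound_by_derive (f f' : R -> R) (a b e : R) :
  (forall x, is_derive x (1 : R) f (f' x)) -> f a = 0 -> 0 <= e ->
  (forall x, x \in `[a, b] -> `|f' x| <= e) ->
  forall x, x \in `[a, b] -> `|f x| <= e * (b - a).
Proof.
move=> df fa0 e0 f'e x /[dup] xab /[!in_itv]/= /andP[ax xb].
have [|t tax E] := @MVT_segment R f f' a x ax (fun x _ => df x).
  by apply: continuous_subspaceT; exact: derive_continuous df.
rewrite -[f x]subr0 -fa0 E normrM ler_pM//; last by rewrite ger0_norm ?subr_ge0// lerD2r.
by apply: f'e; move: tax; rewrite !in_itv/= => /andP[-> /le_trans]; exact.
Qed.

End SineApproximation.

(** * Symmetry of mixed partial derivatives *)

Section Schwarz.
Context (R : realType).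

Lemma MVT_increment (f f' : R -> R) (x h : R) : 0 < h ->
  (forall t, is_derive t (1 : R) f (f' t)) ->
  exists2 t, x <= t <= x + h & f (x + h) - f x = f' t * h.
Proof.
move=> h0 df; have [||t] := @MVT_segment R f f' x (x + h).
- by rewrite lerDl ltW.
- by apply: continuous_subspaceT; exact: derive_continuous df.
by rewrite in_itv/= (addrC x) addrK => txh E; exists t.
Qed.

(** The mean value theorem is applied in x to the difference of two horizontal sections, and then in
    y to [f1]. *)
Lemma mixed_increment (f f1 f12 : R * R -> R) (x y h : R) : 0 < h ->
  (forall p, is_derive p (e1 R) f (f1 p)) ->
  (forall p, is_derive p (e2 R) f1 (f12 p)) ->
  exists2 q, (x <= q.1 <= x + h) /\ (y <= q.2 <= y + h) &
    f (x + h, y + h) - f (x + h, y) - f (x, y + h) + f (x, y) = f12 q * h ^+ 2.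
Proof.
move=> h0 d1 d12.
have dx z t : is_derive t (1 : R) (fun t => f (t, z)) (f1 (t, z)).
  by have /is_derive_e1 := d1 (t, z).
have [s sx sE] := @MVT_increment (fun t => f (t, y + h) - f (t, y))
  (fun t => f1 (t, y + h) - f1 (t, y)) x h h0 (fun t => is_deriveB (dx _ _) (dx _ _)).
have dy t : is_derive t (1 : R) (fun t => f1 (s, t)) (f12 (s, t)).
  by have /is_derive_e2 := d12 (s, t).
have [t ty tE] := MVT_increment y h0 dy.
exists (s, t) => //; move: sE; rewrite tE => sE.
by rewrite expr2 mulrA -sE; ring.
Qed.

(** One second difference over a small square is h^2 times a value of [f12] and also h^2 times a
    value of [f21]; continuity at the corner brings both values to (x, y). *)
Lemma schwarz (f f1 f2 f12 f21 : R * R -> R) : has_grad f f1 f2 ->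
  (forall p, is_derive p (e2 R) f1 (f12 p)) ->
  (forall p, is_derive p (e1 R) f2 (f21 p)) ->
  continuous f12 -> continuous f21 -> f12 =1 f21.
Proof.
move=> [d1 d2] d12 d21 c12 c21 [x y].
apply/eqP; rewrite -subr_eq0 -normr_eq0 eq_le normr_ge0 andbT.
apply/ler_addgt0Pr => e e0; rewrite add0r.
have e2 : 0 < e / 2 by rewrite divr_gt0.
have /cvgrPdist_lt/(_ _ e2)/nbhs_ballP[r1 /= r10 h1] := c12 (x, y).
have /cvgrPdist_lt/(_ _ e2)/nbhs_ballP[r2 /= r20 h2] := c21 (x, y).
pose r := Num.min r1 r2; have r0 : 0 < r by rewrite lt_min r10.
pose h := r / 2; have h0 : 0 < h by rewrite divr_gt0.
have inr (q : R * R) s : x <= q.1 <= x + h -> y <= q.2 <= y + h -> r <= s -> ball (x, y) s q.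
  have hr : h < r by rewrite /h; lra.
  move=> /andP[q1 q2] /andP[q3 q4] rs.
  by split; rewrite /ball/= distrC ltr_norml; apply/andP; split; lra.
have [q [q1 q2] qE] := mixed_increment x y h0 d1 d12.
(* With the coordinates exchanged, the same lemma differentiates in the other order. *)
pose sw (p : R * R) := (p.2, p.1).
have [q' [q1' q2'] qE'] := @mixed_increment (f \o sw) (f2 \o sw) (f21 \o sw) y x h h0
  (fun p => (is_derive_e1 (f \o sw) p (f2 (sw p))).2 ((is_derive_e2 f (sw p) _).1 (d2 (sw p))))
  (fun p => (is_derive_e2 (f2 \o sw) p (f21 (sw p))).2 ((is_derive_e1 f2 (sw p) _).1 (d21 (sw p)))).
have E : f12 q = f21 (sw q').
  apply: (mulIf (x := h ^+ 2)); first by rewrite expf_eq0/= gt_eqF.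
  by rewrite -qE -[RHS]qE' /sw/=; ring.
have hq : `|f12 (x, y) - f12 q| < e / 2 by apply/h1/inr => //; rewrite ge_min lexx.
have hq' : `|f21 (x, y) - f21 (sw q')| < e / 2.
  by apply/h2/inr => //; rewrite ge_min lexx orbT.
rewrite (_ : _ - _ = (f12 (x, y) - f12 q) - (f21 (x, y) - f21 (sw q'))); last first.
  by rewrite E; ring.
by rewrite (le_trans (ler_normB _ _))//; lra.
Qed.

End Schwarz.

(** Let D = f - U. As f vanishes on the right and upper sides, f minus the corrected U is the
    correction of D. This difference and its two partial derivatives are thus sums of four terms,
    all controlled by [F - P]. *)
Lemma sine_approx (R : realType) (a b c d : R) (f f1 f2 F : R * R -> R) (e : R) :
  a < b -> c < d -> has_grad f f1 f2 ->
  (forall p, is_derive p (e2 R) f1 (F p)) ->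
  (forall p, is_derive p (e1 R) f2 (F p)) ->
  continuous F -> (forall p, ~ rect a b c d p -> f p = 0) ->
  0 < e -> exists w w1 w2, [/\ lin_span (sines a b c d) w, has_grad w w1 w2,
    [/\ continuous w, continuous w1 & continuous w2] &
    forall p, rect a b c d p -> [/\ `|f p - w p| <= e, `|f1 p - w1 p| <= e &
       `|f2 p - w2 p| <= e]].
Proof.
move=> ab cd [df1 df2] dF1 dF2 cF f0 e0.
pose L := b - a; pose M := d - c.
have L0 : 0 < L by rewrite subr_gt0.
have M0 : 0 < M by rewrite subr_gt0.
(* The three errors will be at most 4 et L M, 4 et M and 4 et L; with this choice their sum is e. *)
pose et := e / (4 * (L * M + L + M)).
have B0 : 0 < L * M + L + M by rewrite addr_gt0// addr_gt0// mulr_gt0.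
have et0 : 0 < et by rewrite divr_gt0// mulr_gt0.
have [P sP FP] := cosine_approx ab cd cF et0.
have [U [U1 [U2 [[dU1 dU2] dP1 dP2 [cU cU1 cU2 cP [Ua U2a U1c sU]]]]]] :=
  cosines_primitive2 ab cd sP.
(* A function that vanishes along a line has zero derivative in its direction: hence f2 = 0 on the
   vertical sides and f1 = 0 on the horizontal ones. *)
have fl p v : (forall t, f (p + t *: v) = 0) -> 'D_v f p = 0.
  move=> f0l; rewrite /derive (_ : (fun h => _) = (fun=> 0)) ?lim_cst//.
  have fp0 : f p = 0 by have := f0l 0; rewrite scale0r addr0.
  by apply/funext => h /=; rewrite (addrC _ p) f0l fp0 subrr scaler0.
have fv y : f (a, y) = 0 /\ f (b, y) = 0.
  by split; apply: f0 => -[/=]; rewrite in_itv/= ltxx ?andbF.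
have fh x : f (x, c) = 0 /\ f (x, d) = 0.
  by split; apply: f0 => -[_ /=]; rewrite in_itv/= ltxx ?andbF.
have fv2 y : f2 (a, y) = 0 /\ f2 (b, y) = 0.
  split.
  - rewrite -(derive_val (is_derive := df2 (a, y))) fl// => t.
    by rewrite /e2 -[_ + _]/(a + t * 0, _) mulr0 addr0; case: (fv (y + t *: 1)).
  - rewrite -(derive_val (is_derive := df2 (b, y))) fl// => t.
    by rewrite /e2 -[_ + _]/(b + t * 0, _) mulr0 addr0; case: (fv (y + t *: 1)).
have fh1 x : f1 (x, c) = 0 /\ f1 (x, d) = 0.
  split.
  - rewrite -(derive_val (is_derive := df1 (x, c))) fl// => t.
    by rewrite /e1 -[_ + _]/(_, c + t * 0) mulr0 addr0; case: (fh (x + t *: 1)).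
  - rewrite -(derive_val (is_derive := df1 (x, d))) fl// => t.
    by rewrite /e1 -[_ + _]/(_, d + t * 0) mulr0 addr0; case: (fh (x + t *: 1)).
pose D p := f p - U p; pose D1 p := f1 p - U1 p; pose D2 p := f2 p - U2 p.
(* Each bound comes from a side where the difference vanishes: [D2] and [D1] are integrated from
   [F - P], and [D] from [D1]. *)
have D2le x y : x \in `[a, b] -> y \in `[c, d] -> `|D2 (x, y)| <= et * L.
  move=> xab ycd; apply: (@bound_by_derive _ (fun x => D2 (x, y))
    (fun x => F (x, y) - P (x, y))) => //.
  - move=> t; apply: is_deriveB.
      by have /is_derive_e1 := dF2 (t, y).
    by have /is_derive_e1 := dP2 (t, y).
  - by rewrite /D2 U2a; have [-> _] := fv2 y; rewrite subrr.
  - exact: ltW.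
  - by move=> t tab; exact: FP.
have D1le x y : x \in `[a, b] -> y \in `[c, d] -> `|D1 (x, y)| <= et * M.
  move=> xab ycd; apply: (@bound_by_derive _ (fun y => D1 (x, y))
    (fun y => F (x, y) - P (x, y))) => //.
  - move=> t; apply: is_deriveB.
      by have /is_derive_e2 := dF1 (x, t).
    by have /is_derive_e2 := dP1 (x, t).
  - by rewrite /D1 U1c; have [-> _] := fh1 x; rewrite subrr.
  - exact: ltW.
  - by move=> t tab; exact: FP.
have Dle x y : x \in `[a, b] -> y \in `[c, d] -> `|D (x, y)| <= et * M * L.
  move=> xab ycd; apply: (@bound_by_derive _ (fun x => D (x, y))
    (fun x => D1 (x, y))) => //.
  - move=> t; apply: is_deriveB.
      by have /is_derive_e1 := df1 (t, y).
    by have /is_derive_e1 := dU1 (t, y).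
  - by rewrite /D Ua; have [-> _] := fv y; rewrite subrr.
  - by rewrite mulr_ge0// ltW.
  - by move=> t tab; exact: D1le.
pose al x := (x - a) / L; pose be y := (y - c) / M.
exists (correct a b c d U).
exists (fun p => U1 p - L^-1 * U (b, p.2) - be p.2 * U1 (p.1, d) + L^-1 * be p.2 * U (b, d)).
exists (fun p => U2 p - al p.1 * U2 (b, p.2) - M^-1 * U (p.1, d) + al p.1 * M^-1 * U (b, d)).
split => //.
- have gb : has_grad (fun p => U (b, p.2)) (fun=> 0) (fun p => U2 (b, p.2)).
    split => p; first by apply/is_derive_e1 => /=; exact: is_derive_cst.
    by apply/is_derive_e2 => /=; have /is_derive_e2 := dU2 (b, p.2).
  have gd : has_grad (fun p => U (p.1, d)) (fun p => U1 (p.1, d)) (fun=> 0).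
    split => p; last by apply/is_derive_e2 => /=; exact: is_derive_cst.
    by apply/is_derive_e1 => /=; have /is_derive_e1 := dU1 (p.1, d).
  have ga : has_grad (fun p => L^-1 * (p.1 - a)) (fun=> L^-1) (fun=> 0).
    split => p; last by apply/is_derive_e2 => /=; exact: is_derive_cst.
    by apply/is_derive_e1 => /=; exact: is_derive_affine.
  have gc : has_grad (fun p => M^-1 * (p.2 - c)) (fun=> 0) (fun=> M^-1).
    split => p; first by apply/is_derive_e1 => /=; exact: is_derive_cst.
    by apply/is_derive_e2 => /=; exact: is_derive_affine.
  have gk : has_grad (fun=> U (b, d)) (fun=> 0) (fun=> 0).
    by split => p; exact: is_derive_cst.
  have gU : has_grad U U1 U2 by [].
  have := has_gradD (has_gradB (has_gradB gU (has_gradM ga gb)) (has_gradM gc gd))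
    (has_gradM (has_gradM ga gc) gk).
  congr has_grad; apply/funext => p.
  + by rewrite /correct -/L -/M; ring.
  + by rewrite /be; ring.
  + by rewrite /al; ring.
- have c1 (g : R -> R) : continuous g -> continuous (fun p : R * R => g p.1).
    by move=> cg p; apply: (continuous_comp _ (cg _)); exact: cvg_fst.
  have c2 (g : R -> R) : continuous g -> continuous (fun p : R * R => g p.2).
    by move=> cg p; apply: (continuous_comp _ (cg _)); exact: cvg_snd.
  have calb (k m : R) : continuous ((fun x => (x - m) / k) : R -> R).
    by move=> x; apply: cvgM; [apply: cvgB; [exact: cvg_id|]|]; exact: cvg_cst.
  have cal := c1 _ (calb L a); have cbe := c2 _ (calb M c).
  have cUb := c2 _ (continuous_pairr (x := b) cU); have cUd := c1 _ (continuous_pairl (y := d) cU).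
  have cU2b := c2 _ (continuous_pairr (x := b) cU2); have cU1d := c1 _ (continuous_pairl (y := d) cU1).
  have ck (k : R) : continuous ((fun=> k) : R * R -> R) by move=> p; exact: cvg_cst.
  split.
  + exact: continuous_add (continuous_sub (continuous_sub cU (continuous_mul cal cUb))
      (continuous_mul cbe cUd)) (continuous_mul (continuous_mul cal cbe) (ck (U (b, d)))).
  + exact: continuous_add (continuous_sub (continuous_sub cU1 (continuous_mul (ck L^-1) cUb))
      (continuous_mul cbe cU1d)) (continuous_mul (continuous_mul (ck L^-1) cbe) (ck (U (b, d)))).
  + exact: continuous_add (continuous_sub (continuous_sub cU2 (continuous_mul cal cU2b))
      (continuous_mul (ck M^-1) cUd)) (continuous_mul (continuous_mul cal (ck M^-1)) (ck (U (b, d)))).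
move=> [x y] [/= xab ycd].
have bab : b \in `[a, b] by rewrite in_itv/= lexx ltW.
have dcd : d \in `[c, d] by rewrite in_itv/= lexx ltW.
have {}xab : x \in `[a, b] by exact: subset_itv_oo_cc xab.
have {}ycd : y \in `[c, d] by exact: subset_itv_oo_cc ycd.
have al1 : `|al x| <= 1.
  move: xab; rewrite in_itv/= => /andP[ax xb]; rewrite ger0_norm.
    by rewrite ler_pdivrMr// mul1r lerD2r.
  by rewrite divr_ge0 ?subr_ge0// ltW.
have be1 : `|be y| <= 1.
  move: ycd; rewrite in_itv/= => /andP[cy yd]; rewrite ger0_norm.
    by rewrite ler_pdivrMr// mul1r lerD2r.
  by rewrite divr_ge0 ?subr_ge0// ltW.
have [_ fb0] := fv y; have [_ fb2] := fv2 y; have [_ fd0] := fh x.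
have [_ fd1] := fh1 x; have [_ fbd] := fv d.
have eE : e = 4 * (et * M * L) + 4 * (et * M) + 4 * (et * L).
  rewrite /et; field; rewrite gt_eqF//.
have M0' : 0 <= et * M := mulr_ge0 (ltW et0) (ltW M0).
have L0' : 0 <= et * L := mulr_ge0 (ltW et0) (ltW L0).
have ML0 : 0 <= et * M * L := mulr_ge0 M0' (ltW L0).
have four (p q r s B : R) : `|p| <= B -> `|q| <= B -> `|r| <= B -> `|s| <= B ->
    `|p - q - r + s| <= 4 * B.
  move=> hp hq hr hs.
  rewrite (le_trans (ler_normD _ _))// (le_trans (lerD (ler_normB _ _) hs))//.
  rewrite (le_trans (lerD (lerD (ler_normB _ _) hr) (lexx _)))//. lra.
split.
- rewrite (_ : _ - _ = D (x, y) - al x * D (b, y) - be y * D (x, d)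
    + al x * be y * D (b, d)); last first.
    by rewrite /correct /D fb0 fd0 fbd/= -/(al x) -/(be y); ring.
  rewrite (@le_trans _ _ (4 * (et * M * L)))//; last by rewrite eE; lra.
  apply: four.
  + exact: Dle.
  + by rewrite (normrM (al x)) (le_trans (ler_piMl (normr_ge0 _) al1))// Dle.
  + by rewrite (normrM (be y)) (le_trans (ler_piMl (normr_ge0 _) be1))// Dle.
  + rewrite (normrM (al x * be y)) (normrM (al x)).
    by rewrite (le_trans (ler_piMl (normr_ge0 _) _)) ?Dle ?mulr_ile1.
- rewrite (_ : _ - _ = D1 (x, y) - L^-1 * D (b, y) - be y * D1 (x, d)
    + be y * (L^-1 * D (b, d))); last first.
    by rewrite /D1 /D fb0 fd1 fbd/=; ring.
  rewrite (@le_trans _ _ (4 * (et * M)))//; last by rewrite eE; lra.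
  have LD z : z \in `[c, d] -> `|L^-1 * D (b, z)| <= et * M.
    move=> zcd; rewrite normrM gtr0_norm ?invr_gt0// mulrC ler_pdivrMr//.
    exact: Dle.
  apply: four.
  + exact: D1le.
  + exact: LD.
  + by rewrite (normrM (be y)) (le_trans (ler_piMl (normr_ge0 _) be1))// D1le.
  + by rewrite (normrM (be y)) (le_trans (ler_piMl (normr_ge0 _) be1))// LD.
- rewrite (_ : _ - _ = D2 (x, y) - al x * D2 (b, y) - M^-1 * D (x, d)
    + al x * (M^-1 * D (b, d))); last first.
    by rewrite /D2 /D fb2 fd0 fbd/=; ring.
  rewrite (@le_trans _ _ (4 * (et * L)))//; last by rewrite eE; lra.
  have MD z : z \in `[a, b] -> `|M^-1 * D (z, d)| <= et * L.
    move=> zab; rewrite normrM gtr0_norm ?invr_gt0// mulrC ler_pdivrMr// mulrAC.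
    exact: Dle.
  apply: four.
  + exact: D2le.
  + by rewrite (normrM (al x)) (le_trans (ler_piMl (normr_ge0 _) al1))// D2le.
  + exact: MD.
  + by rewrite (normrM (al x)) (le_trans (ler_piMl (normr_ge0 _) al1))// MD.
Qed.

(** * Smooth functions of one variable *)

Section SmoothFunctions.
Context (R : realType).

Lemma Ck1_cst k (m : R) : Ck1 k (fun=> m).
Proof.
elim: k m => [|k ih] m; first by move=> x; exact: cvg_cst.
by exists (fun=> 0); [move=> x; exact: is_derive_cst|exact: ih].
Qed.

Lemma Ck1_affine k (l m : R) : Ck1 k (fun x => l * (x - m)).
Proof.
case: k => [|k]; last first.
  by exists (fun=> l); [move=> x; exact: is_derive_affine|exact: Ck1_cst].
by move=> x; apply: cvgM; [|apply: cvgB; [exact: cvg_id|]]; exact: cvg_cst.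
Qed.

Lemma Ck1_expR k : Ck1 k (@expR R).
Proof.
elim: k => [|k ih]; first exact: continuous_expR.
by exists expR => // x; exact: is_derive_expR.
Qed.

Lemma Ck1Z k (m : R) f : Ck1 k f -> Ck1 k (fun x => m * f x).
Proof. exact: Ck1M (Ck1_cst k m). Qed.

Lemma Ck1_sincos k : Ck1 k (@sin R) /\ Ck1 k (@cos R).
Proof.
elim: k => [|k [ihs ihc]].
  by split; [exact: continuous_sin|exact: continuous_cos].
split; first by exists cos => // x; exact: is_derive_sin.
exists (fun x => - sin x); first by move=> x; exact: is_derive_cos.
by have := Ck1Z (-1) ihs; congr Ck1; apply/funext => x; rewrite mulN1r.
Qed.

Definition expx (al x : R) : R := expR (al * x).

Lemma Ck1_expx k al : Ck1 k (expx al).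
Proof.
have -> : expx al = (fun x => expR (al * (x - 0))).
  by apply/funext => x; rewrite subr0.
by apply: (Ck1_comp (Ck1_expR k)); exact: Ck1_affine.
Qed.

Lemma Ck1_sinx k (a b : R) j : Ck1 k (sinx a b j).
Proof.
by have [cs _] := Ck1_sincos k; apply: (Ck1_comp cs); exact: Ck1_affine.
Qed.

Lemma expxN al x : expx (- al) x * expx al x = 1.
Proof. by rewrite /expx mulNr -expRD addNr expR0. Qed.

End SmoothFunctions.

(** * Approximation of test functions by exponentially weighted sines *)

Section WeightedSines.
Context (R : realType) (a b c d : R) (ab : a < b) (cd : c < d).
Local Notation K := (rect a b c d).
Implicit Types (p : R * R).

Lemma H1sq_le (u u1 u2 : R * R -> R) (e : R) : continuous u -> continuous u1 -> continuous u2 ->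
  (forall p, K p -> [/\ `|u p| <= e, `|u1 p| <= e & `|u2 p| <= e]) ->
  H1sq a b c d u u1 u2 <= 3 * (e ^+ 2 * ((b - a) * (d - c))).
Proof.
move=> cu cu1 cu2 le.
have sq (v : R * R -> R) : continuous v -> (forall p, K p -> `|v p| <= e) ->
    integral2 K (fun p => v p ^+ 2) <= e ^+ 2 * ((b - a) * (d - c)).
  move=> cv ve; rewrite -integral2_cst//; apply: le_integral2.
  - by have /inL2_1P[] := inL2_continuous ab cd cv.
  - by apply: continuous_integrable_rect => // p; exact: cvg_cst.
  - move=> p Kp; rewrite -real_normK ?num_real//.
    by rewrite ler_sqr ?nnegrE ?(le_trans _ (ve p Kp))// ve.
have := sq _ cu (fun p Kp => let: And3 h _ _ := le p Kp in h).
have := sq _ cu1 (fun p Kp => let: And3 _ h _ := le p Kp in h).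
have := sq _ cu2 (fun p Kp => let: And3 _ _ h := le p Kp in h).
rewrite /H1sq; lra.
Qed.

Lemma small_sqr (B e : R) : 0 < B -> 0 < e ->
  exists2 t : R, 0 < t & t ^+ 2 * B < e.
Proof.
(* Since t <= 1, one has t^2 B <= t B <= e / 2. *)
move=> B0 e0; pose t := Num.min 1 (e / (2 * B)).
have e2B : 0 < e / (2 * B) by rewrite divr_gt0// mulr_gt0.
have t0 : 0 < t by rewrite lt_min ltr01.
exists t => //; have t1 : t <= 1 by rewrite ge_min lexx.
have te : t <= e / (2 * B) by rewrite ge_min lexx orbT.
apply: (@le_lt_trans _ _ (e / (2 * B) * B)); last first.
  by rewrite invfM mulrA mulfVK ?gt_eqF// ltr_pdivrMr// ltr_pMr// ltr1n.
rewrite ler_wpM2r ?(ltW B0)// expr2 (le_trans _ te)// ler_piMl//.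
exact: ltW.
Qed.

(** These are the functions [omega] once [al] and [be] are the coordinates of a / (2 mu). *)
Definition expsines (al be : R) : set (R * R -> R) :=
  [set f | exists j s, [/\ (0 < j)%N, (0 < s)%N &
    f = (fun p => (expx al p.1 * expx be p.2) * (sinx a b j p.1 * sinx c d s p.2))]].

Lemma lin_span_map (F F' : set (R * R -> R)) (g w : R * R -> R) :
  (forall f, F f -> F' (fun p => g p * f p)) -> lin_span F w ->
  lin_span F' (fun p => g p * w p).
Proof.
move=> FF' [n [k [fs [Ffs ->]]]]; exists n, k, (fun i p => g p * fs i p).
split; first by move=> i; exact: FF'.
by apply/funext => p; rewrite mulr_sumr; apply: eq_bigr => i _; rewrite mulrCA.
Qed.

Lemma expsines_adherent (al be : R) (phi : R * R -> R) :
  test_function K phi -> H1_adherent K (lin_span (expsines al be)) phi.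
Proof.
move=> tphi; apply/H1_adherentP => // eps eps0.
pose E p := expx al p.1 * expx be p.2.
pose E' p := expx (- al) p.1 * expx (- be) p.2.
have EE' p : E p * E' p = 1.
  by rewrite /E /E' mulrACA (mulrC (expx al p.1)) (mulrC (expx be p.2)) !expxN mulr1.
have CE : Ck 1 E by apply: Ck_tensor; exact: Ck1_expx.
have CE' : Ck 2 E' by apply: Ck_tensor; exact: Ck1_expx.
have Cphi : Ck 2 phi by case: tphi => /(_ 2%N).
pose psi p := E' p * phi p.
have /CkS[cpsi [psi1 [psi2 [gpsi /CkS[cpsi1 [psi11 [psi12 [[_ g12] _ [c12 _]]]]]
  /CkS[cpsi2 [psi21 [psi22 [[g21 _] [c21 _] _]]]]]]]] : Ck 2 psi by exact: CkM.
have sym := schwarz gpsi g12 g21 c12 c21.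
have /CkS[cE [E1 [E2 [gE [cE1 _] [cE2 _]]]]] := CE.
have [M [M0 M1 M2]] : exists M, [/\ forall p, K p -> `|E p| <= M,
    forall p, K p -> `|E1 p| <= M & forall p, K p -> `|E2 p| <= M].
  have [m0 m00 h0] := continuous_bounded_rect ab cd cE.
  have [m1 m10 h1] := continuous_bounded_rect ab cd cE1.
  have [m2 m20 h2] := continuous_bounded_rect ab cd cE2.
  exists (m0 + m1 + m2); split=> p Kp.
  - by rewrite (le_trans (h0 p Kp))//; lra.
  - by rewrite (le_trans (h1 p Kp))//; lra.
  - by rewrite (le_trans (h2 p Kp))//; lra.
have Kmid : K ((a + b) / 2, (c + d) / 2).
  by split; exact: mid_in_itvoo.
have M_ge0 : 0 <= M by exact: le_trans (M0 _ Kmid).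
have [e e0 eeps] : exists2 e : R, 0 < e & e ^+ 2 * (3 * ((b - a) * (d - c))) < eps.
  by apply: small_sqr => //; rewrite !mulr_gt0// subr_gt0.
(* By the product rule each partial derivative of E (psi - w) is at most 2 M de; the added 1 keeps
   the denominator positive when M is only known to be nonnegative. *)
pose de := e / (2 * M + 1).
have de0 : 0 < de by rewrite divr_gt0//; lra.
have Mde : 2 * M * de <= e by rewrite mulrA ler_pdivrMr; [nra|lra].
have [||w [w1 [w2 [sw gw [cw cw1 cw2] hw]]]] := @sine_approx _ _ _ _ _ _ _ _ psi12 _ ab cd
  gpsi g12 _ c12 _ de0.
- by move=> p; rewrite sym.
- by move=> p Kp; rewrite /psi (test_function0 tphi Kp) mulr0.
have gdiff := has_gradM gE (has_gradB gpsi gw).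
have diffE : (fun p => phi p - E p * w p) = (fun p => E p * (psi p - w p)).
  by apply/funext => p; rewrite mulrBr /psi mulrA EE' mul1r.
exists (fun p => E p * w p), (fun p => E1 p * (psi p - w p) + E p * (psi1 p - w1 p)),
  (fun p => E2 p * (psi p - w p) + E p * (psi2 p - w2 p)).
have c0 : continuous (fun p => E p * (psi p - w p)).
  by move=> p; apply: cvgM; [exact: cE|apply: cvgB; [exact: cpsi|exact: cw]].
have c1 : continuous (fun p => E1 p * (psi p - w p) + E p * (psi1 p - w1 p)).
  by move=> p; apply: cvgD; apply: cvgM; [exact: cE1|apply: cvgB; [exact: cpsi|exact: cw]
    |exact: cE|apply: cvgB; [exact: cpsi1|exact: cw1]].
have c2 : continuous (fun p => E2 p * (psi p - w p) + E p * (psi2 p - w2 p)).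
  by move=> p; apply: cvgD; apply: cvgM; [exact: cE2|apply: cvgB; [exact: cpsi|exact: cw]
    |exact: cE|apply: cvgB; [exact: cpsi2|exact: cw2]].
split.
- apply: lin_span_map sw => f [j [s [j0 s0 ->]]]; exists j, s; split => //.
- by rewrite diffE; exact: C1_H1_gradient.
- rewrite diffE; apply: le_lt_trans (eeps).
  rewrite mulrCA; apply: H1sq_le => // p Kp; have [h0 h1 h2] := hw p Kp.
  have Mde0 : 0 <= M * de by rewrite mulr_ge0// ltW.
  have two (x y z t : R) : `|x| <= M -> `|y| <= de -> `|z| <= M -> `|t| <= de ->
      `|x * y + z * t| <= e.
    move=> hx hy hz ht; rewrite (le_trans (ler_normD _ _))// !normrM.
    by rewrite (le_trans (lerD (ler_pM _ _ hx hy) (ler_pM _ _ hz ht)))//; lra.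
  split; [|exact: two (M1 p Kp) h0 (M0 p Kp) h1|exact: two (M2 p Kp) h0 (M0 p Kp) h2].
  rewrite normrM (le_trans (ler_pM _ _ (M0 p Kp) h0))//; lra.
Qed.

End WeightedSines.

(** * Cutoff functions *)

Section FlatFunction.
Context (R : realType).

(** The powers of 1/t make the family of multiples of exp(-1/t) stable under differentiation up to
    linear combinations, so that smoothness is an induction on the order. *)
Definition flat (m : nat) (t : R) : R :=
  if 0 < t then t^-1 ^+ m * expR (- t^-1) else 0.

Lemma flat_ge0 m t : 0 <= flat m t.
Proof.
rewrite /flat; case: ifP => // t0.
by rewrite mulr_ge0 ?expR_ge0// exprn_ge0// invr_ge0 ltW.
Qed.

(** A single term of the exponential series is at most exp s. *)
Lemma expr_expRN (m : nat) (s : R) : 0 <= s -> s ^+ m * expR (- s) <= (m`!)%:R.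
Proof.
move=> s0; rewrite expRN ler_pdivrMr ?expR_gt0//.
case: m => [|m]; first by rewrite expr0 mul1r (le_trans _ (expR_ge1Dx s))// lerDl.
rewrite mulrC -ler_pdivrMr ?ltr0n ?fact_gt0//.
by rewrite (le_trans _ (expR_ge1Dxn m s0))// lerDr.
Qed.

Lemma flat_le m t : flat m t <= (m`!)%:R.
Proof.
rewrite /flat; case: ifP => // t0.
by apply: expr_expRN; rewrite invr_ge0 ltW.
Qed.

Lemma flat_recurrence m t : t * flat m.+1 t = flat m t.
Proof.
rewrite /flat; case: ifP => t0; last by rewrite mulr0.
by rewrite exprS mulrA mulrA divff ?mul1r// gt_eqF.
Qed.

Lemma is_derive_flat m t :
  is_derive t (1 : R) (flat m) (- m%:R * flat m.+1 t + flat m.+2 t).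
Proof.
have [t0|t0|t0] := ltgtP 0 t.
- have near_t : \forall s \near t, s^-1 ^+ m * expR (- s^-1) = flat m s.
    near=> s; rewrite /flat ifT//; near: s; exact: lt_nbhsr.
  apply: (near_eq_is_derive near_t).
  have tN0 : t != 0 by rewrite gt_eqF.
  have dV : is_derive t (1 : R) (fun s => s^-1) (- t ^- 2).
    have := @is_deriveV R id t 1 1 tN0 _; rewrite /GRing.scale/= mulr1; apply.
  have dX : is_derive t (1 : R) (fun s => s^-1 ^+ m) (m%:R * t^-1 ^+ m.-1 * (- t ^- 2)).
    have -> : (fun s => s^-1 ^+ m) = ((fun s => s^-1) : R -> R) ^+ m.
      by apply/funext => s; rewrite exprfctE.
    exact: is_deriveX dV.
  have dE : is_derive t (1 : R) (fun s => expR (- s^-1)) (expR (- t^-1) * (t ^- 2)).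
    have dN : is_derive t (1 : R) (fun s => - s^-1) (t ^- 2).
      by rewrite -[t ^- 2]opprK; exact: is_deriveN.
    exact: (@is_derive1_comp_fun R expR expR _ (fun t => t ^- 2) t dN _).
  have := is_derive_mul dX dE; congr is_derive.
  rewrite /flat t0; case: m {near_t dX} => [|m] /=.
    by rewrite expr0 expr1; field.
  by rewrite !exprS; field.
- have near_t : \forall s \near t, 0 = flat m s.
    near=> s; rewrite /flat ifF//; apply/negbTE; rewrite -leNgt ltW//.
    by near: s; exact: lt_nbhsl.
  apply: (near_eq_is_derive near_t).
  rewrite /flat ltNge (ltW t0)/= mulr0 addr0.
  exact: is_derive_cst.
- rewrite -t0 /flat ltxx mulr0 addr0.
  have cv : (fun h => h^-1 *: ((flat m \o shift 0) (h *: 1) - flat m 0)) @ 0^' --> (0 : R).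
    have -> : (fun h => h^-1 *: ((flat m \o shift 0) (h *: 1) - flat m 0)) =
        (fun h => h^-1 * flat m h).
      apply/funext => h; rewrite /= [flat m 0]/flat ltxx subr0 addr0.
      by rewrite /GRing.scale/= mulr1.
    apply/cvgr0Pnorm_lt => e e0.
    near=> h.
    have hN0 : h != 0 by near: h; exact: nbhs_dnbhs_neq.
    (* At 0 the difference quotient is [flat m.+1 h], that is h times [flat m.+2 h], and its
       absolute value is at most |h| (m+2)!. *)
    rewrite -flat_recurrence mulKf// -flat_recurrence normrM.
    rewrite (@le_lt_trans _ _ (`|h| * (m.+2`!)%:R))//.
      by rewrite ler_wpM2l// ger0_norm ?flat_ge0 ?flat_le.
    rewrite -ltr_pdivlMr ?ltr0n ?fact_gt0//.
    near: h; apply: dnbhs0_lt; by rewrite divr_gt0// ltr0n fact_gt0.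
  by apply: DeriveDef; [apply/cvg_ex; exists 0|exact: cvg_lim cv].
Unshelve. all: by end_near.
Qed.

Lemma Ck1_flat k m : Ck1 k (flat m).
Proof.
elim: k m => [|k ih] m; first exact: derive_continuous (is_derive_flat m).
exists (fun t => - m%:R * flat m.+1 t + flat m.+2 t); first exact: is_derive_flat.
by apply: Ck1D; [apply: Ck1Z|]; exact: ih.
Qed.

Lemma flat_cvg m (u : nat -> R) : u @ \oo --> +oo ->
  (fun n => flat m (u n)) @ \oo --> ((m == 0)%:R : R).
Proof.
move=> uoo.
have vu : (fun n => (u n)^-1) @ \oo --> (0 : R).
  by apply/gtr0_cvgV0 => //; move/cvgryPgt : uoo; exact.
have : (fun n => (u n)^-1 ^+ m * expR (- (u n)^-1)) @ \oo --> (0 : R) ^+ m * expR (- 0).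
  apply: cvgM; first exact: cvg_comp vu (@exprn_continuous R m 0).
  exact: cvg_comp (cvgN vu) (@continuous_expR R (- 0)).
rewrite oppr0 expR0 mulr1 expr0n.
apply: cvg_trans; apply: near_eq_cvg; near=> n.
rewrite /flat ifT//; near: n; move/cvgryPgt : uoo; exact.
Unshelve. all: by end_near.
Qed.

End FlatFunction.

Section Cutoff.
Context (R : realType) (a b : R) (ab : a < b).

Definition parab (x : R) : R := (x - a) * (b - x).

Definition cutoff (n : nat) (x : R) : R := flat 0 (n.+1%:R * parab x - 1).

Definition dcutoff (n : nat) (x : R) : R :=
  flat 2 (n.+1%:R * parab x - 1) * (n.+1%:R * (a + b - 2 * x)).

Lemma is_derive_cutoff n x : is_derive x (1 : R) (cutoff n) (dcutoff n x).
Proof.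
have dx : is_derive x (1 : R) (fun x => n.+1%:R * parab x - 1) (n.+1%:R * (a + b - 2 * x)).
  have h1 := is_derive_affine 1 a x; have h2 := is_derive_affine (- 1) b x.
  have := is_deriveB (is_derive_scale n.+1%:R (is_derive_mul h1 h2))
    (is_derive_cst (1 : R) x (1 : R)).
  have -> : (fun y : R => n.+1%:R * (1 * (y - a) * (-1 * (y - b)))) - cst 1 =
      (fun x => n.+1%:R * parab x - 1).
    by apply/funext => y; rewrite /parab !fctE; ring.
  by congr is_derive; ring.
have := @is_derive1_comp_fun R (flat 0) (fun t => - 0%:R * flat 1 t + flat 2 t)
  _ (fun x => n.+1%:R * (a + b - 2 * x)) x dx (is_derive_flat 0 _).
by congr is_derive; rewrite /dcutoff mulr0n oppr0 mul0r add0r.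
Qed.

Lemma Ck1_cutoff k n : Ck1 k (cutoff n).
Proof.
apply: (Ck1_comp (Ck1_flat R k 0)).
have -> : (fun x => n.+1%:R * parab x - 1) =
    (fun x => (n.+1%:R * (x - a)) * (-1 * (x - b)) + (-1)).
  by apply/funext => y; rewrite /parab; ring.
by apply: Ck1D; [apply: Ck1M; exact: Ck1_affine|exact: Ck1_cst].
Qed.

Lemma parab_gt0 x : x \in `]a, b[ -> 0 < parab x.
Proof. by rewrite in_itv/= => /andP[ax xb]; rewrite mulr_gt0// subr_gt0. Qed.

Lemma cutoff_supp n : exists a' b', [/\ a < a', b' < b &
  forall x, x \notin `[a', b'] -> cutoff n x = 0].
Proof.
(* A nonzero value forces [parab x] above 1/(n+1). Each factor of [parab] is then below b - a, so
   the other one exceeds r. *)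
pose r := n.+1%:R^-1 / (b - a).
have ba0 : 0 < b - a by rewrite subr_gt0.
have r0 : 0 < r by rewrite divr_gt0// invr_gt0.
exists (a + r), (b - r); split; [by rewrite ltrDl|by rewrite gtrBl|].
move=> x; apply: contraNeq => cx.
have : 0 < n.+1%:R * parab x - 1.
  by move: cx; rewrite /cutoff /flat; case: ifP => //; rewrite eqxx.
rewrite subr_gt0 mulrC -ltr_pdivrMr// div1r => hq.
have hq' : r * (b - a) < parab x by rewrite divfK ?gt_eqF.
have q0 : 0 < parab x by rewrite (lt_trans _ hq')// mulr_gt0.
rewrite in_itv/=; move: hq' q0; rewrite /parab => hq' q0.
have ax : a < x by rewrite ltNge; apply/negP => xa; nra.
have xb : x < b by rewrite ltNge; apply/negP => bx; nra.
by apply/andP; split; nra.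
Qed.

Lemma cutoff_bound n x : 0 <= cutoff n x <= 1.
Proof. by rewrite flat_ge0 (le_trans (flat_le _ _)). Qed.

(** With t the argument of [flat], (n+1) [parab x] is t + 1, and t times [flat 2 t] is [flat 1 t].
    Thus n survives only inside [flat], where the expression is bounded and tends to 0 at interior
    points. *)
Lemma parab_dcutoff n x : parab x * dcutoff n x =
  (flat 1 (n.+1%:R * parab x - 1) + flat 2 (n.+1%:R * parab x - 1)) * (a + b - 2 * x).
Proof.
by rewrite /dcutoff; set t := _ - 1; rewrite -(flat_recurrence 1 t) /t; ring.
Qed.

Lemma cutoff_argument_cvg x : x \in `]a, b[ ->
  (fun n => n.+1%:R * parab x - 1) @ \oo --> +oo.
Proof.
move=> /parab_gt0 q0; apply/cvgryPge => A; near=> n.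
rewrite lerBrDr -ler_pdivrMr// ltW// (@lt_le_trans _ _ n%:R) ?ler_nat//.
near: n; exact: nbhs_infty_gtr.
Unshelve. all: by end_near.
Qed.

Lemma le_parab (f f' : R -> R) : (forall x, is_derive x (1 : R) f (f' x)) ->
  continuous f' -> f a = 0 -> f b = 0 ->
  exists2 C, 0 <= C & forall x, x \in `]a, b[ ->
    [/\ `|f x| <= C * parab x, `|f x| <= C & `|f' x| <= C].
Proof.
move=> df cf' fa fb.
have cf := derive_continuous df.
have bnd (g : R -> R) : continuous g -> exists2 M, 0 <= M & forall x, x \in `[a, b] -> `|g x| <= M.
  move=> cg; have [||x xab h] := @EVT_max R (fun x => `|g x|) a b.
  - exact: ltW.
  - by apply: continuous_subspaceT => x; apply: cvg_norm; exact: cg.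
  - by exists `|g x|.
have [M M0 hM] := bnd _ cf'; have [M' M'0 hM'] := bnd _ cf.
have ba0 : 0 < b - a by rewrite subr_gt0.
(* The mean value theorem bounds |f x| by M times the distance to the nearer end, while the distance
   to the other end is at least (b - a) / 2; this gives 2 M / (b - a). The terms M and M' bound f'
   and f. *)
exists (2 * M / (b - a) + M + M').
  by rewrite !addr_ge0// divr_ge0 ?mulr_ge0// ltW.
have M2 : 0 <= 2 * M / (b - a) by rewrite divr_ge0 ?mulr_ge0// ltW.
move=> x xab; have xab' : x \in `[a, b] by exact: subset_itv_oo_cc xab.
have q0 := parab_gt0 xab.
split; [|by have := hM' _ xab'; lra|by have := hM _ xab'; lra].
apply: (@le_trans _ _ (2 * M / (b - a) * parab x)); last first.
  by rewrite ler_wpM2r ?(ltW q0)//; lra.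
move: (xab); rewrite in_itv/= => /andP[ax xb].
have mvt u v : a <= u -> u < v -> v <= b -> `|f v - f u| <= M * (v - u).
  move=> au uv vb.
  have [|t tuv ->] := @MVT_segment R f f' u v (ltW uv) (fun x _ => df x).
    exact: continuous_subspaceT.
  have vu0 : 0 <= v - u by rewrite subr_ge0 ltW.
  rewrite normrM (ger0_norm vu0) ler_wpM2r//.
  apply: hM; move: tuv; rewrite !in_itv/= => /andP[ut tv].
  by rewrite (le_trans au)//= (le_trans tv).
have h1 := mvt a x (lexx _) ax (ltW xb); have h2 := mvt x b (ltW ax) xb (lexx _).
rewrite fa subr0 in h1; rewrite fb sub0r normrN in h2.
rewrite mulrAC ler_pdivlMr// /parab.
have [xm|xm] := leP (x - a) (b - x).
  rewrite (le_trans (ler_wpM2r (ltW ba0) h1))//.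
  have : 0 <= M * (x - a) * ((b - x) - (x - a)) by rewrite !mulr_ge0 ?subr_ge0// ltW.
  nra.
rewrite (le_trans (ler_wpM2r (ltW ba0) h2))//.
have : 0 <= M * (b - x) * ((x - a) - (b - x)) by rewrite !mulr_ge0 ?subr_ge0// ltW.
nra.
Qed.

(* [f * dcutoff n] stays bounded because [f] is dominated by [parab] and
   [parab * dcutoff n] is bounded. *)
Lemma cutoff_approx (f f' : R -> R) : (forall x, is_derive x (1 : R) f (f' x)) ->
  continuous f' -> f a = 0 -> f b = 0 ->
  exists C, forall x, x \in `]a, b[ ->
  [/\ forall n, `|f x * cutoff n x| <= C,
      forall n, `|f' x * cutoff n x + f x * dcutoff n x| <= C,
      (fun n => f x * cutoff n x) @ \oo --> f x &
      (fun n => f' x * cutoff n x + f x * dcutoff n x) @ \oo --> f' x].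
Proof.
move=> df cf' fa fb; have [C C0 hC] := le_parab df cf' fa fb.
(* Here 3 = 1! + 2! bounds the sum of [flat 1] and [flat 2], b - a bounds |a + b - 2 x|, and C
   bounds both f / [parab] and the terms containing the cutoff itself. *)
exists (C + 3 * C * (b - a)) => x xab; have [h1 h2 h3] := hC x xab.
have q0 := parab_gt0 xab.
have ba0 : 0 < b - a by rewrite subr_gt0.
have CB : 0 <= 3 * C * (b - a) by rewrite !mulr_ge0// ltW.
have dq : `|a + b - 2 * x| <= b - a.
  by move: xab; rewrite in_itv/= => /andP[ax xb]; rewrite ler_norml; apply/andP; split; lra.
have quot n : f x * dcutoff n x = f x / parab x * (a + b - 2 * x) *
  (flat 1 (n.+1%:R * parab x - 1) + flat 2 (n.+1%:R * parab x - 1)).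
  rewrite -mulrA (mulrC (a + b - 2 * x)) -parab_dcutoff mulrA divfK//.
  by rewrite gt_eqF.
have cut1 (z : R) n : `|z| <= C -> `|z * cutoff n x| <= C.
  move=> zC; rewrite normrM; have /andP[k0 k1] := cutoff_bound n x.
  by rewrite (ger0_norm k0) (le_trans (ler_piMr _ k1)).
have tcvg := cutoff_argument_cvg xab.
have cut_cvg (z : R) : (fun n => z * cutoff n x) @ \oo --> z.
  have := cvgM (cvg_cst z) (flat_cvg (m := 0) tcvg).
  by rewrite /= mulr1; apply.
split.
- by move=> n; rewrite (le_trans (cut1 _ n h2))// lerDl.
- move=> n; rewrite (le_trans (ler_normD _ _))// lerD ?cut1// quot !normrM.
  rewrite -mulrA (_ : 3 * C * (b - a) = C * ((b - a) * 3)); last by ring.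
  rewrite ler_pM ?mulr_ge0 ?normr_ge0//.
    by rewrite normfV (gtr0_norm q0) ler_pdivrMr.
  rewrite ler_pM// ger0_norm ?addr_ge0 ?flat_ge0//.
  have f1 : flat 1 (n.+1%:R * parab x - 1) <= 1%:R := flat_le 1 _.
  have f2 : flat 2 (n.+1%:R * parab x - 1) <= 2%:R := flat_le 2 _.
  lra.
- exact: cut_cvg.
- rewrite -[X in _ --> X]addr0; apply: cvgD; first exact: cut_cvg.
  under eq_fun do rewrite quot.
  have := cvgM (cvg_cst (f x / parab x * (a + b - 2 * x)))
    (cvgD (flat_cvg (m := 1) tcvg) (flat_cvg (m := 2) tcvg)).
  by rewrite /= addr0 mulr0; apply.
Qed.

End Cutoff.

(** * Dominated convergence and tensor products in H^1_0 *)

Section DominatedConvergence.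
Context (R : realType) (a b c d : R) (ab : a < b) (cd : c < d).
Local Notation K := (rect a b c d).
Local Notation mu := (@lebesgue_measure R).

Lemma bounded_cvg_integral2 (D : nat -> R * R -> R) (C : R) :
  (forall n, continuous (D n)) -> (forall n p, K p -> `|D n p| <= C) ->
  (forall p, K p -> (fun n => D n p) @ \oo --> (0 : R)) ->
  (fun n => integral2 K (fun p => D n p ^+ 2)) @ \oo --> (0 : R).
Proof.
move=> cD DC D0.
have cD2 n : continuous (fun p => D n p ^+ 2) by move=> p; exact: cvgM (cD n p) (cD n p).
suff : ((\int[mu \x mu]_(p in K) (D n p ^+ 2)%:E)%E @[n --> \oo] -->
    (\int[mu \x mu]_(p in K) (cst 0%E p))%E).
  by rewrite integral0 => h; exact: fine_cvg h.
apply: (@dominated_cvg _ _ R (mu \x mu)%E K _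
  (fun n p => (D n p ^+ 2)%:E) (fun=> 0%E) (fun=> (C ^+ 2)%:E)).
- exact: measurable_rect.
- move=> n; apply/measurable_EFinP; apply: continuous_measurable2 => //.
  exact: measurable_rect.
- move=> p Kp; apply: cvg_EFin; first exact: nearW.
  by have := cvgM (D0 p Kp) (D0 p Kp); rewrite mulr0; apply.
- by [].
- apply: (@continuous_integrable_rect R a b c d ab cd (fun=> C ^+ 2)) => p.
  exact: cvg_cst.
- move=> n p Kp; rewrite abse_EFin lee_fin ger0_norm ?sqr_ge0//.
  rewrite -real_normK ?num_real// ler_sqr ?nnegrE//; first exact: DC.
  exact: le_trans (DC n p Kp).
Qed.

End DominatedConvergence.

Section TensorH10.
Context (R : realType) (a b c d : R) (ab : a < b) (cd : c < d).
Local Notation K := (rect a b c d).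

Lemma continuous_dcutoff (a' b' : R) n : continuous (dcutoff a' b' n).
Proof.
have -> : dcutoff a' b' n = (fun x =>
    flat 2 ((n.+1%:R * (x - a')) * (-1 * (x - b')) + (-1)) *
    ((- n.+1%:R * 2) * (x - (a' + b') / 2))).
  by apply/funext => x; rewrite /dcutoff /parab; congr (flat 2 _ * _); [ring|field].
apply: (@Ck1_continuous _ 0); apply: Ck1M; last exact: Ck1_affine.
apply: (Ck1_comp (Ck1_flat R 0 2)).
by apply: Ck1D; [apply: Ck1M; exact: Ck1_affine|exact: Ck1_cst].
Qed.

Lemma test_function_tensor (f g : R -> R) (a' b' c' d' : R) :
  (forall k, Ck1 k f) -> (forall k, Ck1 k g) ->
  a < a' -> b' < b -> c < c' -> d' < d ->
  (forall x, x \notin `[a', b'] -> f x = 0) ->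
  (forall x, x \notin `[c', d'] -> g x = 0) ->
  test_function K (fun p => f p.1 * g p.2).
Proof.
move=> Cf Cg aa bb cc dd f0 g0.
pose Q : set (R * R) := `[a', b']%classic `*` `[c', d']%classic.
have cQ : compact Q by apply: compact_setX; exact: segment_compact.
have clQ : closed Q by apply: compact_closed => //; exact: norm_hausdorff.
have suppQ : closure [set p : R * R | f p.1 * g p.2 != 0] `<=` Q.
  rewrite [X in _ `<=` X](closure_id Q).1//; apply: closure_subset => -[x y] /= fg.
  split => /=; apply: contraNT fg => xy; first by rewrite f0 ?mul0r.
  by rewrite g0 ?mulr0.
split; first by move=> k; exact: Ck_tensor.
- by apply: subclosed_compact cQ suppQ; exact: closed_closure.
- apply: subset_trans suppQ _ => -[x y] [/=]; rewrite !in_itv/=.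
  move=> /andP[ax xb] /andP[cy yd]; split; rewrite /= in_itv/=.
    by rewrite (lt_le_trans aa)//= (le_lt_trans xb).
  by rewrite (lt_le_trans cc)//= (le_lt_trans yd).
Qed.

(** Each factor is cut off separately, so the approximations remain tensor products and the
    one-variable limits of [cutoff_approx] simply multiply. *)
Lemma tensor_inH10 (f f' g g' : R -> R) :
  (forall k, Ck1 k f) -> (forall x, is_derive x (1 : R) f (f' x)) -> continuous f' ->
  f a = 0 -> f b = 0 ->
  (forall k, Ck1 k g) -> (forall x, is_derive x (1 : R) g (g' x)) -> continuous g' ->
  g c = 0 -> g d = 0 ->
  inH10 K (fun p => f p.1 * g p.2).
Proof.
move=> Cf df cf' fa fb Cg dg cg' gc gd.
have [cf cg] := (derive_continuous df, derive_continuous dg).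
split.
  exists (fun p => f' p.1 * g p.2), (fun p => f p.1 * g' p.2).
  by apply: (C1_H1_gradient ab cd); [exact: has_grad_tensor|exact: continuous_tensor..].
pose fn n x := f x * cutoff a b n x; pose gn n x := g x * cutoff c d n x.
pose fn' n x := f' x * cutoff a b n x + f x * dcutoff a b n x.
pose gn' n x := g' x * cutoff c d n x + g x * dcutoff c d n x.
have Cfn n k : Ck1 k (fn n) by apply: Ck1M => //; exact: Ck1_cutoff.
have Cgn n k : Ck1 k (gn n) by apply: Ck1M => //; exact: Ck1_cutoff.
have dfn n x : is_derive x (1 : R) (fn n) (fn' n x).
  by apply: is_derive_mul; exact: is_derive_cutoff.
have dgn n x : is_derive x (1 : R) (gn n) (gn' n x).
  by apply: is_derive_mul; exact: is_derive_cutoff.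
have [cfn cgn] := (fun n => derive_continuous (dfn n), fun n => derive_continuous (dgn n)).
have ccut a' b' n : continuous (cutoff a' b' n) := derive_continuous (is_derive_cutoff a' b' n).
have cfn' n : continuous (fn' n).
  by move=> x; apply: cvgD; apply: cvgM; [exact: cf'|exact: ccut|exact: cf|exact: continuous_dcutoff].
have cgn' n : continuous (gn' n).
  by move=> x; apply: cvgD; apply: cvgM; [exact: cg'|exact: ccut|exact: cg|exact: continuous_dcutoff].
have [A1 hA1] := cutoff_approx ab df cf' fa fb.
have [A2 hA2] := cutoff_approx cd dg cg' gc gd.
have [A3 A30 hA3] := le_parab ab df cf' fa fb.
have [A4 A40 hA4] := le_parab cd dg cg' gc gd.
(* A common bound for all factors, so that the function and both partial derivatives share the
   dominating constant B B + B B. *)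
pose B := `|A1| + `|A2| + A3 + A4.
have leB x : [/\ x <= A1 -> x <= B, x <= A2 -> x <= B, x <= A3 -> x <= B & x <= A4 -> x <= B].
  have := ler_norm A1; have := ler_norm A2; have := normr_ge0 A1; have := normr_ge0 A2.
  by move=> *; split; rewrite /B => ?; lra.
have hf x : x \in `]a, b[ -> [/\ forall n, `|fn n x| <= B, forall n, `|fn' n x| <= B,
    `|f x| <= B & `|f' x| <= B].
  move=> /[dup] /hA1[h1 h2 _ _] /hA3[_ h3 h4]; split => [n|n||].
  - by have [+ _ _ _] := leB `|fn n x|; apply; exact: h1.
  - by have [+ _ _ _] := leB `|fn' n x|; apply; exact: h2.
  - by have [_ _ + _] := leB `|f x|; apply.
  - by have [_ _ + _] := leB `|f' x|; apply.
have hg x : x \in `]c, d[ -> [/\ forall n, `|gn n x| <= B, forall n, `|gn' n x| <= B,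
    `|g x| <= B & `|g' x| <= B].
  move=> /[dup] /hA2[h1 h2 _ _] /hA4[_ h3 h4]; split => [n|n||].
  - by have [_ + _ _] := leB `|gn n x|; apply; exact: h1.
  - by have [_ + _ _] := leB `|gn' n x|; apply; exact: h2.
  - by have [_ _ _ +] := leB `|g x|; apply.
  - by have [_ _ _ +] := leB `|g' x|; apply.
have two (x y z t : R) : `|x| <= B -> `|y| <= B -> `|z| <= B -> `|t| <= B ->
    `|x * y - z * t| <= B * B + B * B.
  move=> hx hy hz ht; rewrite (le_trans (ler_normB _ _))// !normrM.
  by rewrite lerD// ler_pM.
have cvg2 (u v : nat -> R) (x y : R) : u @ \oo --> x -> v @ \oo --> y ->
    (fun n => x * y - u n * v n) @ \oo --> (0 : R).
  move=> ux vy; rewrite -[X in _ --> X](subrr (x * y)).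
  by apply: cvgB; [exact: cvg_cst|exact: cvgM].
have ctB (u v u' v' : R -> R) : continuous u -> continuous v -> continuous u' -> continuous v' ->
    continuous (fun p : R * R => u p.1 * v p.2 - u' p.1 * v' p.2).
  move=> cu cv cu' cv' p.
  by apply: cvgB; [exact: (continuous_tensor cu cv)|exact: (continuous_tensor cu' cv')].
have lim0 := @bounded_cvg_integral2 R a b c d ab cd
  (fun n p => f p.1 * g p.2 - fn n p.1 * gn n p.2) (B * B + B * B).
have lim1 := @bounded_cvg_integral2 R a b c d ab cd
  (fun n p => f' p.1 * g p.2 - fn' n p.1 * gn n p.2) (B * B + B * B).
have lim2 := @bounded_cvg_integral2 R a b c d ab cd
  (fun n p => f p.1 * g' p.2 - fn n p.1 * gn' n p.2) (B * B + B * B).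
have {}lim0 : (fun n => integral2 K (fun p => (f p.1 * g p.2 - fn n p.1 * gn n p.2) ^+ 2))
    @ \oo --> (0 : R).
  apply: lim0 => [n|n p [p1 p2]|p [p1 p2]]; first exact: ctB.
  - by have [? ? ? ?] := hf _ p1; have [? ? ? ?] := hg _ p2; exact: two.
  - by have [_ _ ? ?] := hA1 _ p1; have [_ _ ? ?] := hA2 _ p2; exact: cvg2.
have {}lim1 : (fun n => integral2 K (fun p => (f' p.1 * g p.2 - fn' n p.1 * gn n p.2) ^+ 2))
    @ \oo --> (0 : R).
  apply: lim1 => [n|n p [p1 p2]|p [p1 p2]]; first exact: ctB.
  - by have [? ? ? ?] := hf _ p1; have [? ? ? ?] := hg _ p2; exact: two.
  - by have [_ _ ? ?] := hA1 _ p1; have [_ _ ? ?] := hA2 _ p2; exact: cvg2.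
have {}lim2 : (fun n => integral2 K (fun p => (f p.1 * g' p.2 - fn n p.1 * gn' n p.2) ^+ 2))
    @ \oo --> (0 : R).
  apply: lim2 => [n|n p [p1 p2]|p [p1 p2]]; first exact: ctB.
  - by have [? ? ? ?] := hf _ p1; have [? ? ? ?] := hg _ p2; exact: two.
  - by have [_ _ ? ?] := hA1 _ p1; have [_ _ ? ?] := hA2 _ p2; exact: cvg2.
apply/H1_adherentP => eps eps0.
have limH : (fun n => H1sq a b c d (fun p => f p.1 * g p.2 - fn n p.1 * gn n p.2)
    (fun p => f' p.1 * g p.2 - fn' n p.1 * gn n p.2)
    (fun p => f p.1 * g' p.2 - fn n p.1 * gn' n p.2)) @ \oo --> (0 : R).
  have z : 0 + 0 + 0 = 0 :> R by rewrite !addr0.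
  rewrite -[X in _ --> X]z; exact: cvgD (cvgD lim0 lim1) lim2.
have [n _ /(_ n (leqnn n)) hn] := (cvgr0Pnorm_lt _).1 limH _ eps0.
exists (fun p => fn n p.1 * gn n p.2).
exists (fun p => f' p.1 * g p.2 - fn' n p.1 * gn n p.2).
exists (fun p => f p.1 * g' p.2 - fn n p.1 * gn' n p.2).
split.
- have [a' [b' [aa bb fs]]] := cutoff_supp ab n.
  have [c' [d' [cc dd gs]]] := cutoff_supp cd n.
  apply: (@test_function_tensor _ _ a' b' c' d') => // x.
    by move=> /fs; rewrite /fn => ->; rewrite mulr0.
  by move=> /gs; rewrite /gn => ->; rewrite mulr0.
- apply: (C1_H1_gradient ab cd); [|exact: ctB..].
  by apply: has_gradB; exact: has_grad_tensor.
- by rewrite (le_lt_trans (ler_norm _) hn).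
Qed.

End TensorH10.

(** * Orthonormality and completeness *)

Section SineOrthogonality.
Context (R : realType) (a b : R) (ab : a < b).

(** With truncated subtraction, (j - k) + (k - j) is |j - k|, which is the right frequency because
    cos is even. *)
Lemma sinxM j k x : sinx a b j x * sinx a b k x =
  (cosx a b ((j - k) + (k - j)) x - cosx a b (j + k) x) / 2.
Proof.
rewrite /sinx /cosx; set w := pi / (b - a) * (x - b).
have E n : n%:R * pi / (b - a) * (x - b) = n%:R * w by rewrite /w !mulrA.
rewrite !E (natrD _ j k) (mulrDl j%:R) cosD.
have -> : cos (((j - k) + (k - j))%:R * w) = cos (j%:R * w - k%:R * w).
  have [jk|/ltnW jk] := leqP k j.
    by rewrite (eqP (jk : k - j == 0)%N) addn0 natrB// mulrBl.
  by rewrite (eqP (jk : j - k == 0)%N) add0n natrB// mulrBl -cosN opprB.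
by rewrite cosB; field.
Qed.

Lemma integral_cosx n : (\int[@lebesgue_measure R]_(x in `]a, b[) cosx a b n x)%R =
  if n == 0%N then b - a else 0.
Proof.
rewrite (FTC_itv ab (is_derive_sinprim n ^~ ab) (@continuous_cosx R a b n)).
rewrite sinprim_left// subr0 /sinprim; case: ifP => // _.
by rewrite sinx_right mulr0.
Qed.

Lemma continuous_sinx j : continuous (sinx a b j).
Proof. exact: derive_continuous (is_derive_sinx a b j). Qed.

Lemma continuous_sinxM j k : continuous (fun x => sinx a b j x * sinx a b k x).
Proof. by move=> x; apply: cvgM; exact: continuous_sinx. Qed.

Lemma integral_sinxM j k : (0 < j)%N ->
  (\int[@lebesgue_measure R]_(x in `]a, b[) (sinx a b j x * sinx a b k x))%R =
  (j == k)%:R * ((b - a) / 2).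
Proof.
move=> j0; have icos n := continuous_integrable_itv a b (@continuous_cosx R a b n).
under eq_Rintegral do rewrite sinxM.
rewrite RintegralZr; [|exact: measurable_itv|]; last first.
  by apply: continuous_integrable_itv => x; apply: cvgB; exact: continuous_cosx.
rewrite RintegralB; [|exact: measurable_itv|exact: icos|exact: icos].
(* The frequency |j - k| vanishes exactly when j = k, and j + k never vanishes because 0 < j. *)
rewrite !integral_cosx addn_eq0 !subn_eq0 -eqn_leq addn_eq0 (gtn_eqF j0)/= subr0 eq_sym.
by case: (k == j); rewrite ?mul1r ?mul0r.
Qed.

End SineOrthogonality.

Lemma H1_adherentS (R : realType) (O : set (R * R)) (A B : set (R * R -> R)) u :
  A `<=` B -> H1_adherent O A u -> H1_adherent O B u.
Proof.
by move=> AB uA e e0; have [w [r [Aw wr re]]] := uA e e0; exists w, r; split => //; exact: AB.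
Qed.

(** * The normalised sine system on a cell of the mesh *)

Section Cell.
Context (R : realType) (N l1 l2 : nat) (mu : R) (v : R * R).
Context (N2 : (2 < N)%N) (hl1 : (2 <= l1 <= N)%N) (hl2 : (2 <= l2 <= N)%N) (mu0 : 0 < mu).
Local Notation h := (mesh R N).
Local Notation a := (node R N l1.-1).
Local Notation b := (node R N l1).
Local Notation c := (node R N l2.-1).
Local Notation d := (node R N l2).
Local Notation K := (@cell R N l1 l2).
Local Notation al := ((2 * mu)^-1 * v.1).
Local Notation be := ((2 * mu)^-1 * v.2).

Lemma mesh_gt0 : 0 < h.
Proof. by rewrite invr_gt0 ltr0n -subn1 subn_gt0 (ltn_trans _ N2). Qed.

(** From l = 2 on, neither of the two predecessors is truncated at 0. *)
Lemma node_step l : (2 <= l)%N -> node R N l - node R N l.-1 = h.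
Proof.
case: l => [|[|l]]// _; rewrite /node -mulrBl /=.
by rewrite -natrB// subSnn mul1r.
Qed.

Lemma node_lt l : (2 <= l)%N -> node R N l.-1 < node R N l.
Proof. by move=> /node_step E; rewrite -subr_gt0 E mesh_gt0. Qed.

Let ab : a < b. Proof. by apply: node_lt; case/andP: hl1. Qed.
Let cd : c < d. Proof. by apply: node_lt; case/andP: hl2. Qed.
Let bah : b - a = h. Proof. by apply: node_step; case/andP: hl1. Qed.
Let dch : d - c = h. Proof. by apply: node_step; case/andP: hl2. Qed.

Let mK : measurable K := @measurable_rect R a b c d.

Lemma sqrt_sigma j : Num.sqrt (sigma R N j) = j%:R * pi / h.
Proof.
rewrite /sigma sqrtr_sqr ger0_norm// divr_ge0 ?(ltW mesh_gt0)//.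
by rewrite mulr_ge0// pi_ge0.
Qed.

Lemma exp_dot p : expR ((2 * mu)^-1 * dot v p) = expx al p.1 * expx be p.2.
Proof. by rewrite /expx -expRD /dot mulrDr !mulrA. Qed.

Lemma omegaE js p : omega N l1 l2 mu v js p =
  expx al p.1 * expx be p.2 * (sinx a b js.1 p.1 * sinx c d js.2 p.2).
Proof. by rewrite /omega exp_dot !sqrt_sigma /sinx bah dch mulrA. Qed.

Lemma weight_omega js ks p : weight mu v p * omega N l1 l2 mu v js p *
    omega N l1 l2 mu v ks p =
  (sinx a b js.1 p.1 * sinx a b ks.1 p.1) * (sinx c d js.2 p.2 * sinx c d ks.2 p.2).
Proof.
have E : weight mu v p * (expx al p.1 * expx be p.2) * (expx al p.1 * expx be p.2) = 1.
  rewrite -exp_dot /weight -mulrA -!expRD -[RHS]expR0; congr expR.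
  by field; rewrite gt_eqF.
by rewrite !omegaE -[RHS]mul1r -[X in _ = X * _]E; ring.
Qed.

Lemma L2inner_omega js ks : pos_pairs js -> pos_pairs ks ->
  L2inner K (weight mu v) (omega N l1 l2 mu v js) (omega N l1 l2 mu v ks) =
  (js == ks)%:R * (h / 2) ^+ 2.
Proof.
move=> [j1 j2] _; rewrite /L2inner; under eq_fun do rewrite weight_omega.
have := integral2_tensor ab cd (@continuous_sinxM R a b js.1 ks.1) (@continuous_sinxM R c d js.2 ks.2).
rewrite !integral_sinxM// bah dch => -> /=.
rewrite mulrACA -natrM mulnb -expr2; congr (_%:R * _).
Qed.

Lemma L2norm_omega js : pos_pairs js ->
  L2norm K (weight mu v) (omega N l1 l2 mu v js) = h / 2.
Proof.
move=> pjs; rewrite /L2norm L2inner_omega// eqxx mul1r sqrtr_sqr ger0_norm//.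
by rewrite divr_ge0// ltW// mesh_gt0.
Qed.

Lemma zetaE js p : pos_pairs js ->
  zeta N l1 l2 mu v js p = 2 / h * omega N l1 l2 mu v js p.
Proof. by move=> pjs; rewrite /zeta L2norm_omega// invf_div mulrC. Qed.

(** Separates the variables as [tensor_inH10] requires; the constant 2 / h goes to the first
    factor. *)
Lemma zeta_tensor js : pos_pairs js -> zeta N l1 l2 mu v js =
  (fun p => (2 / h * (expx al p.1 * sinx a b js.1 p.1)) *
            (expx be p.2 * sinx c d js.2 p.2)).
Proof.
move=> pjs; apply/funext => p.
by rewrite zetaE// omegaE !mulrA -!(mulrA (2 / h)); congr (_ * _); ring.
Qed.

Lemma Ck1_zeta1 (js : nat * nat) k :
  Ck1 k (fun x => 2 / h * (expx al x * sinx a b js.1 x)).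
Proof. by apply: Ck1Z; apply: Ck1M; [exact: Ck1_expx|exact: Ck1_sinx]. Qed.

Lemma Ck1_zeta2 (js : nat * nat) k : Ck1 k (fun y => expx be y * sinx c d js.2 y).
Proof. by apply: Ck1M; [exact: Ck1_expx|exact: Ck1_sinx]. Qed.

Lemma zeta_explicit js p : pos_pairs js -> zeta N l1 l2 mu v js p =
  2 * expR ((2 * mu)^-1 * dot v p) / h *
    sin (Num.sqrt (sigma R N js.1) * (p.1 - node R N l1)) *
    sin (Num.sqrt (sigma R N js.2) * (p.2 - node R N l2)).
Proof. by move=> pjs; rewrite zetaE// /omega; ring. Qed.

Lemma zeta_orthonormal :
  orthonormal_in_L2 K (weight mu v) pos_pairs (zeta N l1 l2 mu v).
Proof.
have hN0 : h != 0 by rewrite gt_eqF// mesh_gt0.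
have zz js ks p : pos_pairs js -> pos_pairs ks ->
    weight mu v p * zeta N l1 l2 mu v js p * zeta N l1 l2 mu v ks p =
    (2 / h) ^+ 2 * (weight mu v p * omega N l1 l2 mu v js p * omega N l1 l2 mu v ks p).
  by move=> pj pk; rewrite !zetaE//; ring.
have iomega js ks : integrable2 K (fun p => weight mu v p * omega N l1 l2 mu v js p *
    omega N l1 l2 mu v ks p).
  under eq_fun do rewrite weight_omega.
  apply: (continuous_integrable_rect ab cd).
  exact: continuous_tensor (@continuous_sinxM R a b js.1 ks.1) (@continuous_sinxM R c d js.2 ks.2).
split=> [js pjs|js ks pj pk].
- split.
    apply: continuous_measurable2; first exact: mK.
    rewrite zeta_tensor//.
    exact: continuous_tensor (Ck1_continuous (Ck1_zeta1 js 0))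
      (Ck1_continuous (Ck1_zeta2 js 0)).
  apply/integrable2P; first exact: mK.
  rewrite (_ : (fun p => _) = (fun p => (2 / h) ^+ 2 * (weight mu v p *
    omega N l1 l2 mu v js p * omega N l1 l2 mu v js p))); first exact: integrable2Z.
  by apply/funext => p; rewrite expr2 mulrA zz.
- have := L2inner_omega pj pk; rewrite /L2inner.
  under [in X in _ -> X]eq_fun do rewrite zz//.
  have E : 2 / h * (h / 2) = 1 by rewrite -(invf_div h) mulVf// mulf_neq0// invr_eq0 pnatr_eq0.
  by rewrite integral2Z// => ->; rewrite mulrCA -exprMn E expr1n mulr1.
Qed.

Lemma zeta_complete : complete_in_H10 K (zeta N l1 l2 mu v @` pos_pairs).
Proof.
have hN0 : h != 0 by rewrite gt_eqF// mesh_gt0.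
split=> [_ [js pjs <-]|u [_ uadh]].
- rewrite zeta_tensor//.
  have [[f' df cf'] [g' dg cg']] := (Ck1_zeta1 js 1, Ck1_zeta2 js 1).
  by apply: (tensor_inH10 ab cd (Ck1_zeta1 js) df cf' _ _ (Ck1_zeta2 js) dg cg');
    rewrite ?(sinx_left _ ab) ?(sinx_left _ cd) ?sinx_right ?mulr0.
- apply: (H1_adherent_trans ab cd uadh) => phi tphi.
  apply: H1_adherentS (expsines_adherent ab cd al be tphi).
  apply: lin_span_ind => [|f g|k f [j [s [j0 s0 ->]]]].
  + exact: lin_span0.
  + exact: lin_spanD.
  + have zs : (zeta N l1 l2 mu v @` pos_pairs) (zeta N l1 l2 mu v (j, s)).
      by exists (j, s).
    have := lin_spanZ (k * (h / 2)) (lin_span_gen zs); congr lin_span.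
    by apply/funext => p; rewrite zetaE// omegaE/=; field.
Qed.

End Cell.

Theorem theorem3p2 (R : realType) (N l1 l2 : nat) (mu : R) (a : R * R)
    (hN : (2 < N)%N) (hl1 : (2 <= l1 <= N)%N) (hl2 : (2 <= l2 <= N)%N)
    (hmu : 0 < mu) :
  let h := mesh R N in
  let K := @cell R N l1 l2 in
  let z := zeta N l1 l2 mu a in
  [/\ forall js, pos_pairs js -> forall x : R * R,
        z js x = 2 * expR ((2 * mu)^-1 * dot a x) / h *
                 sin (Num.sqrt (sigma R N js.1) * (x.1 - node R N l1)) *
                 sin (Num.sqrt (sigma R N js.2) * (x.2 - node R N l2)),
      complete_in_H10 K (z @` pos_pairs) &
      orthonormal_in_L2 K (weight mu a) pos_pairs z].
Proof.
split.
- by move=> js pjs x; exact: zeta_explicit.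
- exact: zeta_complete.
- exact: zeta_orthonormal.
Qed.
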